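(* Let $S$ be a finitely generated standard graded algebra over a commutative ring $R$, let $I$ be a finitely generated ideal of $R$ and let $M$ be a graded $S$-module with $\operatorname{reg}(M)<\infty$. Set $r:=\operatorname{reg}(M)-\operatorname{depth}_{S_+}(M)$, $d:=\min_{\nu>r}\{\operatorname{depth}_I(M_\nu)\}=\operatorname{depth}_I(M_{>r})$ and $\mu_0:=\inf\{\nu>r\mid\operatorname{depth}_I(M_\nu)=d\}$. Then $\operatorname{depth}_I(M_\mu)=d$ for all $\mu\geq\mu_0$.
   Context: No Noetherian hypothesis is made. $S=\bigoplus_{\mu\ge0}S_\mu$ is graded with $S_0=R$, generated as an $R$-algebra by finitely many elements of $S_1$; $S_+=\bigoplus_{\mu>0}S_\mu$. Graded modules are $\mathbf{Z}$-graded and not assumed finitely generated; $M_\mu$ is the degree $\mu$ component (an $R$-module) and $M_{>r}=\bigoplus_{\nu>r}M_\nu$. Indices $\mu,\nu$ range over integers. For a commutative ring $A$, a finitely generated ideal $I=(a_1,\dots,a_r)$ and an $A$-module $N$, $H^i_I(N)$ denotes the $i$-th cohomology module of the Čech complex of $N$ on $a_1,\dots,a_r$. $\operatorname{depth}_I(N):=\max\{p\in\mathbf{N}\cup\{+\infty\}\mid H^i_I(N)=0\ \forall i<p\}$. $\operatorname{reg}(M):=\sup\{\mu\mid\exists i,\ H^i_{S_+}(M)_{\mu-i}\neq0\}$, with $\sup\emptyset=-\infty$. If $\operatorname{depth}_{S_+}(M)=+\infty$ then $\operatorname{reg}(M)=-\infty$ and $r=-\infty$. *)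

(* Defs.v *)
From HB Require Import structures.
From mathcomp Require Import all_boot all_order all_algebra.
From mathcomp Require Import zify ring.
From mathcomp Require Import boolp classical_sets constructive_ereal.

Set Implicit Arguments.
Unset Strict Implicit.
Unset Printing Implicit Defensive.

Import Order.TTheory GRing.Theory Num.Theory.

Local Open Scope quotient_scope.
Local Open Scope classical_set_scope.
Local Open Scope ring_scope.

(** * Submodules, quotients, restriction of scalars *)

Record submodule (A : comPzRingType) (V : lmodType A) := Submodule {
  sm_set :> V -> Prop;
  sm_closed : submod_closed (mem (sm_set : set V))
}.

Definition sm_pred (A : comPzRingType) (V : lmodType A) (W : submodule V) :
  {pred V} := mem (sm_set W : set V).

HB.instance Definition _ (A : comPzRingType) (V : lmodType A)
  (W : submodule V) :=
  GRing.isSubmodClosed.Build A V (sm_pred W) (sm_closed W).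

Lemma sm_predP (A : comPzRingType) (V : lmodType A) (W : submodule V) v :
  reflect (sm_set W v) (v \in sm_pred W).
Proof.
rewrite /sm_pred; apply: (iffP idP); last by move=> h; exact: mem_set.
exact: set_mem.
Qed.

Lemma sm_closedP (A : comPzRingType) (V : lmodType A) (W : set V) :
  W 0 -> (forall a u v, W u -> W v -> W (a *: u + v)) ->
  submod_closed (mem W).
Proof.
move=> W0 WD; split; first exact: mem_set.
by move=> a u v /set_mem Wu /set_mem Wv; apply/mem_set/WD.
Qed.

Record submod_type (A : comPzRingType) (V : lmodType A) (W : submodule V) :=
  SubmodType { submod_val : V; submod_valP : submod_val \in sm_pred W }.

HB.instance Definition _ (A : comPzRingType) (V : lmodType A)
  (W : submodule V) := [isSub for @submod_val A V W].
HB.instance Definition _ (A : comPzRingType) (V : lmodType A)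
  (W : submodule V) := [Choice of submod_type W by <:].
HB.instance Definition _ (A : comPzRingType) (V : lmodType A)
  (W : submodule V) := [SubChoice_isSubLmodule of submod_type W by <:].

Section QuotientModule.
Variables (A : comPzRingType) (V : lmodType A) (W : submodule V).

Definition qequiv (u v : V) := u - v \in sm_pred W.

Lemma qequiv_equiv : equiv_class_of qequiv.
Proof.
split=> [u|u v|v u w]; rewrite /qequiv.
- by rewrite subrr rpred0.
- by rewrite -opprB rpredN.
- by move=> uv vw; rewrite -(subrKA v) rpredD.
Qed.

Canonical qequiv_canonical := EquivRelPack qequiv_equiv.

Definition quotmod : Type := {eq_quot qequiv}.
HB.instance Definition _ := EqQuotient.on quotmod.
HB.instance Definition _ := Choice.on quotmod.

Definition quot_add (x y : quotmod) : quotmod := \pi_quotmod (repr x + repr y).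
Definition quot_opp (x : quotmod) : quotmod := \pi_quotmod (- repr x).
Definition quot_scale (a : A) (x : quotmod) : quotmod :=
  \pi_quotmod (a *: repr x).

Lemma qpiP (u v : V) :
  reflect (\pi_quotmod u = \pi_quotmod v) (u - v \in sm_pred W).
Proof. exact: (iffP (@eqquotP _ _ quotmod u v)). Qed.

Lemma qrepr (u : V) : repr (\pi_quotmod u) - u \in sm_pred W.
Proof. by apply/qpiP; rewrite reprK. Qed.

Lemma quot_addE u v : quot_add (\pi_quotmod u) (\pi_quotmod v) =
  \pi_quotmod (u + v).
Proof. by apply/qpiP; rewrite opprD addrACA rpredD ?qrepr. Qed.
Lemma quot_oppE u : quot_opp (\pi_quotmod u) = \pi_quotmod (- u).
Proof. by apply/qpiP; rewrite -opprD rpredN qrepr. Qed.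
Lemma quot_scaleE a u : quot_scale a (\pi_quotmod u) = \pi_quotmod (a *: u).
Proof. by apply/qpiP; rewrite -scalerBr rpredZ ?qrepr. Qed.

Lemma quot_ind (P : quotmod -> Prop) :
  (forall u, P (\pi_quotmod u)) -> forall x, P x.
Proof. by move=> Pp x; rewrite -[x]reprK. Qed.

Lemma quot_addA : associative quot_add.
Proof.
elim/quot_ind=> u; elim/quot_ind=> v; elim/quot_ind=> w.
by rewrite !quot_addE addrA.
Qed.
Lemma quot_addC : commutative quot_add.
Proof.
by elim/quot_ind=> u; elim/quot_ind=> v; rewrite !quot_addE addrC.
Qed.
Lemma quot_add0 : left_id (\pi_quotmod 0) quot_add.
Proof. by elim/quot_ind=> u; rewrite quot_addE add0r. Qed.
Lemma quot_addN : left_inverse (\pi_quotmod 0) quot_opp quot_add.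
Proof. by elim/quot_ind=> u; rewrite quot_oppE quot_addE addNr. Qed.

HB.instance Definition _ := GRing.isZmodule.Build quotmod
  quot_addA quot_addC quot_add0 quot_addN.

Lemma quot_scaleA a b x :
  quot_scale a (quot_scale b x) = quot_scale (a * b) x.
Proof. by elim/quot_ind: x => u; rewrite !quot_scaleE scalerA. Qed.
Lemma quot_scale1 : left_id 1 quot_scale.
Proof. by elim/quot_ind=> u; rewrite quot_scaleE scale1r. Qed.
Lemma quot_scaleDr : right_distributive quot_scale +%R.
Proof.
move=> a; elim/quot_ind=> u; elim/quot_ind=> v.
by rewrite [_ + _]quot_addE !quot_scaleE [RHS]quot_addE scalerDr.
Qed.
Lemma quot_scaleDl x : {morph quot_scale^~ x : a b / a + b}.
Proof.
move=> a b; elim/quot_ind: x => u.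
by rewrite !quot_scaleE [RHS]quot_addE scalerDl.
Qed.

HB.instance Definition _ := GRing.Zmodule_isLmodule.Build A quotmod
  quot_scaleA quot_scale1 quot_scaleDr quot_scaleDl.

End QuotientModule.

Definition restrict (R A : comPzRingType) (phi : {rmorphism R -> A})
  (V : lmodType A) : Type := V.

Section Restrict.
Variables (R A : comPzRingType) (phi : {rmorphism R -> A}) (V : lmodType A).

HB.instance Definition _ := GRing.Zmodule.on (restrict phi V).

Definition restrict_scale (r : R) (v : restrict phi V) : restrict phi V :=
  phi r *: (v : V).

Lemma restrict_scaleA a b v :
  restrict_scale a (restrict_scale b v) = restrict_scale (a * b) v.
Proof. by rewrite /restrict_scale scalerA rmorphM. Qed.
Lemma restrict_scale1 : left_id 1 restrict_scale.
Proof. by move=> v; rewrite /restrict_scale rmorph1 scale1r. Qed.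
Lemma restrict_scaleDr : right_distributive restrict_scale +%R.
Proof. by move=> a u v; rewrite /restrict_scale scalerDr. Qed.
Lemma restrict_scaleDl v : {morph restrict_scale^~ v : a b / a + b}.
Proof. by move=> a b; rewrite /restrict_scale rmorphD scalerDl. Qed.

HB.instance Definition _ := GRing.Zmodule_isLmodule.Build R (restrict phi V)
  restrict_scaleA restrict_scale1 restrict_scaleDr restrict_scaleDl.

End Restrict.

(** * Localization of a module at the powers of one element *)

Section Localization.
Variables (A : comPzRingType) (N : lmodType A) (f : A).

(* The pair (m, k) stands for the fraction m / f ^ k. *)
Definition frac_equiv (x y : N * nat) : bool :=
  `[< exists e, f ^+ (e + y.2) *: x.1 = f ^+ (e + x.2) *: y.1 >].

Lemma frac_equiv_equiv : equiv_class_of frac_equiv.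
Proof.
split=> [x|x y|y x z]; rewrite /frac_equiv.
- by apply/asboolP; exists 0%N.
- by apply/asbool_equiv_eq; split=> -[e he]; exists e.
- move=> /asboolP[e he] /asboolP[e' he']; apply/asboolP.
  exists (e + e' + y.2)%N.
  have -> : (e + e' + y.2 + z.2 = (e' + z.2) + (e + y.2))%N by lia.
  rewrite exprD -scalerA he scalerA mulrC -scalerA he' scalerA -exprD.
  by congr (_ ^+ _ *: _); lia.
Qed.

Canonical frac_equiv_canonical := EquivRelPack frac_equiv_equiv.

Definition loc : Type := {eq_quot frac_equiv}.
HB.instance Definition _ := EqQuotient.on loc.
HB.instance Definition _ := Choice.on loc.

Definition frac (m : N) (k : nat) : loc := \pi_loc (m, k).

Lemma fracP m k m' k' :
  frac m k = frac m' k' <->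
  exists e, f ^+ (e + k') *: m = f ^+ (e + k) *: m'.
Proof.
split=> [/eqquotP/asboolP //|h].
by apply/eqquotP/asboolP.
Qed.

Lemma frac_repr (x : loc) : x = frac (repr x).1 (repr x).2.
Proof. by rewrite /frac -surjective_pairing reprK. Qed.

Lemma frac_ind (P : loc -> Prop) : (forall m k, P (frac m k)) -> forall x, P x.
Proof. by move=> Pf x; rewrite (frac_repr x). Qed.

Definition loc_add (x y : loc) : loc :=
  frac (f ^+ (repr y).2 *: (repr x).1 + f ^+ (repr x).2 *: (repr y).1)
       ((repr x).2 + (repr y).2).
Definition loc_opp (x : loc) : loc := frac (- (repr x).1) (repr x).2.
Definition loc_scale (a : A) (x : loc) : loc :=
  frac (a *: (repr x).1) (repr x).2.

Lemma loc_addE m k m' k' : loc_add (frac m k) (frac m' k') =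
  frac (f ^+ k' *: m + f ^+ k *: m') (k + k').
Proof.
rewrite /loc_add; apply/fracP.
have /fracP[e] := frac_repr (frac m k).
have /fracP[e'] := frac_repr (frac m' k').
move: (repr _) (repr _) => [n l] [n' l'] /= he' he.
exists (e + e')%N; rewrite !scalerDr !scalerA -!exprD; congr (_ + _).
- have -> : (e + e' + (k + k') + l' = (e' + k' + l') + (e + k))%N by lia.
  rewrite exprD -scalerA -he scalerA -exprD.
  by congr (_ ^+ _ *: _); lia.
- have -> : (e + e' + (k + k') + l = (e + k + l) + (e' + k'))%N by lia.
  rewrite exprD -scalerA -he' scalerA -exprD.
  by congr (_ ^+ _ *: _); lia.
Qed.

Lemma loc_oppE m k : loc_opp (frac m k) = frac (- m) k.
Proof.
rewrite /loc_opp; apply/fracP.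
have /fracP[e he] := frac_repr (frac m k).
by exists e; rewrite !scalerN he.
Qed.

Lemma loc_scaleE a m k : loc_scale a (frac m k) = frac (a *: m) k.
Proof.
rewrite /loc_scale; apply/fracP.
have /fracP[e he] := frac_repr (frac m k).
by exists e; rewrite !scalerA ![_ * a]mulrC -!scalerA he.
Qed.

Lemma loc_addA : associative loc_add.
Proof.
elim/frac_ind=> m k; elim/frac_ind=> m' k'; elim/frac_ind=> m'' k''.
rewrite !loc_addE addnA !scalerDr !scalerA -!exprD addrA.
by congr (frac (_ *: _ + _ *: _ + _ *: _) _); congr (_ ^+ _); lia.
Qed.

Lemma loc_addC : commutative loc_add.
Proof.
by elim/frac_ind=> m k; elim/frac_ind=> m' k'; rewrite !loc_addE addrC addnC.
Qed.

Lemma loc_add0 : left_id (frac 0 0) loc_add.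
Proof.
by elim/frac_ind=> m k; rewrite loc_addE scaler0 add0r scale1r.
Qed.

Lemma loc_addN : left_inverse (frac 0 0) loc_opp loc_add.
Proof.
elim/frac_ind=> m k; rewrite loc_oppE loc_addE scalerN addNr.
by apply/fracP; exists 0%N; rewrite !scaler0.
Qed.

HB.instance Definition _ := GRing.isZmodule.Build loc
  loc_addA loc_addC loc_add0 loc_addN.

Lemma loc_scaleA a b x : loc_scale a (loc_scale b x) = loc_scale (a * b) x.
Proof. by elim/frac_ind: x => m k; rewrite !loc_scaleE scalerA. Qed.
Lemma loc_scale1 : left_id 1 loc_scale.
Proof. by elim/frac_ind=> m k; rewrite loc_scaleE scale1r. Qed.
Lemma loc_scaleDr : right_distributive loc_scale +%R.
Proof.
move=> a; elim/frac_ind=> m k; elim/frac_ind=> m' k'.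
rewrite [_ + _]loc_addE !loc_scaleE [RHS]loc_addE.
by rewrite scalerDr !scalerA ![a * _]mulrC.
Qed.
Lemma loc_scaleDl x : {morph loc_scale^~ x : a b / a + b}.
Proof.
move=> a b; elim/frac_ind: x => m k.
rewrite !loc_scaleE [RHS]loc_addE; apply/fracP; exists 0%N.
by rewrite -scalerDr -scalerDl [RHS]scalerA -exprD !add0n.
Qed.

HB.instance Definition _ := GRing.Zmodule_isLmodule.Build A loc
  loc_scaleA loc_scale1 loc_scaleDr loc_scaleDl.

Lemma fracD m k m' k' :
  frac m k + frac m' k' = frac (f ^+ k' *: m + f ^+ k *: m') (k + k').
Proof. exact: loc_addE. Qed.
Lemma fracN m k : - frac m k = frac (- m) k.
Proof. exact: loc_oppE. Qed.
Lemma fracZ a m k : a *: frac m k = frac (a *: m) k.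
Proof. exact: loc_scaleE. Qed.
Lemma frac0 k : frac 0 k = 0.
Proof. by apply/fracP; exists 0%N; rewrite !scaler0. Qed.

End Localization.

(* The canonical map N_f -> N_g, m / f ^ k |-> b ^ k m / g ^ k, which makes
   sense when g = f * b. *)
Definition loc_map (A : comPzRingType) (N : lmodType A) (f b g : A)
  (x : loc N f) : loc N g :=
  frac g (b ^+ (repr x).2 *: (repr x).1) (repr x).2.

Lemma loc_mapE (A : comPzRingType) (N : lmodType A) (f b g : A) (m : N) k :
  g = f * b -> loc_map b g (frac f m k) = frac g (b ^+ k *: m) k.
Proof.
move=> ->; rewrite /loc_map; apply/fracP.
have /fracP[e] := frac_repr (frac f m k).
move: (repr _) => [n l] /= he.
have E p q (v : N) :
    (f * b) ^+ p *: (b ^+ q *: v) = b ^+ (p + q) *: (f ^+ p *: v).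
  by rewrite exprMn !scalerA exprD [in RHS]mulrC mulrA.
by exists e; rewrite !E he; congr (_ ^+ _ *: _); lia.
Qed.

Lemma loc_map_linear (A : comPzRingType) (N : lmodType A) (f b g : A) c
  (x y : loc N f) : g = f * b ->
  loc_map b g (c *: x + y) = c *: loc_map b g x + loc_map b g y.
Proof.
move=> gE; elim/frac_ind: x => m k; elim/frac_ind: y => m' k'.
rewrite fracZ fracD !loc_mapE // fracZ fracD; congr (frac _ _ _).
rewrite scalerDr !scalerA gE !exprMn exprD.
by congr (_ *: _ + _ *: _); ring.
Qed.

(** * The Cech complex and its cohomology *)

Record fg_ideal (A : comPzRingType) :=
  FgIdeal { fg_num : nat; fg_gen :> 'I_fg_num -> A }.

Definition fg_ideal_set (A : comPzRingType) (I : fg_ideal A) : set A :=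
  [set y | exists c : 'I_(fg_num I) -> A, y = \sum_i c i * I i].

Lemma fg_idealB (A : comPzRingType) (I : fg_ideal A) (a x y : A) :
  fg_ideal_set I x -> fg_ideal_set I y -> fg_ideal_set I (x - a * y).
Proof.
move=> [c ->] [c' ->]; exists (fun i => c i - a * c' i).
rewrite mulr_sumr -sumrB; apply: eq_bigr => i _.
by rewrite mulrBl mulrA.
Qed.

Section Cech.
Variables (A : comPzRingType) (I : fg_ideal A) (N : lmodType A).
Let n := fg_num I.
Implicit Types (J : {set 'I_n}) (p : nat).

Definition cech_prod J : A := \prod_(j in J) I j.

(* All degrees at once: the term of cohomological degree p is the submodule of
   the families supported on the subsets J with p elements. *)
Definition cech : Type := forall J, loc N (cech_prod J).

HB.instance Definition _ := gen_eqMixin cech.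
HB.instance Definition _ := gen_choiceMixin cech.

Definition cech_zero : cech := fun J => 0.
Definition cech_add (c c' : cech) : cech := fun J => c J + c' J.
Definition cech_opp (c : cech) : cech := fun J => - c J.
Definition cech_scale (r : A) (c : cech) : cech := fun J => r *: c J.

Lemma cech_addA : associative cech_add.
Proof. by move=> c c' c''; apply: functional_extensionality_dep => J;
  exact: addrA. Qed.
Lemma cech_addC : commutative cech_add.
Proof. by move=> c c'; apply: functional_extensionality_dep => J;
  exact: addrC. Qed.
Lemma cech_add0 : left_id cech_zero cech_add.
Proof. by move=> c; apply: functional_extensionality_dep => J;
  exact: add0r. Qed.
Lemma cech_addN : left_inverse cech_zero cech_opp cech_add.
Proof. by move=> c; apply: functional_extensionality_dep => J;
  exact: addNr. Qed.

HB.instance Definition _ := GRing.isZmodule.Build cech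
  cech_addA cech_addC cech_add0 cech_addN.

Lemma cech_scaleA r s c :
  cech_scale r (cech_scale s c) = cech_scale (r * s) c.
Proof. by apply: functional_extensionality_dep => J;
  exact: scalerA. Qed.
Lemma cech_scale1 : left_id 1 cech_scale.
Proof. by move=> c; apply: functional_extensionality_dep => J;
  exact: scale1r. Qed.
Lemma cech_scaleDr : right_distributive cech_scale +%R.
Proof. by move=> r c c'; apply: functional_extensionality_dep => J;
  exact: scalerDr. Qed.
Lemma cech_scaleDl c : {morph cech_scale^~ c : r s / r + s}.
Proof. by move=> r s; apply: functional_extensionality_dep => J;
  exact: scalerDl. Qed.

HB.instance Definition _ := GRing.Zmodule_isLmodule.Build A cech
  cech_scaleA cech_scale1 cech_scaleDr cech_scaleDl.

Definition in_cech_degree p (c : cech) : Prop :=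
  forall J, #|J| != p -> c J = 0.

(* (d c)_J is the sum over j in J of (-1)^(position of j in J) times the image
   of c_(J \ j). *)
Definition cech_d (c : cech) : cech := fun J =>
  \sum_(j in J) (-1) ^+ #|[set i in J | (i < j)%N]| *:
    loc_map (I j) (cech_prod J) (c (J :\ j)).

Lemma cech_prodD1 J j : j \in J -> cech_prod J = cech_prod (J :\ j) * I j.
Proof. by move=> jJ; rewrite /cech_prod (big_setD1 j) //= mulrC. Qed.

Lemma cech_d_linear r c c' : cech_d (r *: c + c') = r *: cech_d c + cech_d c'.
Proof.
apply: functional_extensionality_dep => J.
rewrite -[RHS]/(r *: cech_d c J + cech_d c' J) /cech_d scaler_sumr -big_split.
apply: eq_bigr => j jJ.
rewrite -[(r *: c + c') _]/(r *: c _ + c' _).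
rewrite loc_map_linear; last exact: cech_prodD1.
by rewrite scalerDr !scalerA [r * _]mulrC.
Qed.

Lemma cech_d0 : cech_d 0 = 0.
Proof.
have := cech_d_linear (-1) 0 0.
by rewrite scaler0 addr0 scaleN1r addNr.
Qed.

Lemma in_cech_degree_linear p r c c' :
  in_cech_degree p c -> in_cech_degree p c' -> in_cech_degree p (r *: c + c').
Proof.
move=> cp c'p J Jp.
by rewrite -[LHS]/(r *: c J + c' J) cp // c'p // scaler0 addr0.
Qed.

Definition cocycle_set p : set cech :=
  [set c | in_cech_degree p c /\ cech_d c = 0].

Definition coboundary_set p : set cech :=
  [set c | exists b : cech,
     (forall J, (#|J|).+1 != p -> b J = 0) /\ c = cech_d b].

Lemma cocycle_closed p : submod_closed (mem (cocycle_set p)).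
Proof.
apply: sm_closedP; first by split=> //; exact: cech_d0.
move=> r c c' [cp dc] [c'p dc']; split; first exact: in_cech_degree_linear.
by rewrite cech_d_linear dc dc' scaler0 addr0.
Qed.

Definition cocycle p : submodule cech := Submodule (cocycle_closed p).

Definition cocycle_coboundary_set p : set (submod_type (cocycle p)) :=
  [set z | coboundary_set p (val z)].

Lemma cocycle_coboundary_closed p :
  submod_closed (mem (@cocycle_coboundary_set p)).
Proof.
apply: sm_closedP; first by exists (0 : cech); split=> //; rewrite cech_d0.
move=> r c c' [b [bp bE]] [b' [b'p b'E]]; exists (r *: b + b'); split.
  move=> J Jp; rewrite -[LHS]/(r *: b J + b' J) bp // b'p //.
  by rewrite scaler0 addr0.
by rewrite cech_d_linear -bE -b'E.
Qed.

(* Cocycles that are coboundaries; by cech_dd every coboundary is one. *)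
Definition coboundary p : submodule (submod_type (cocycle p)) :=
  Submodule (cocycle_coboundary_closed p).

(* H^p_I(N) *)
Definition cohom p : lmodType A := quotmod (coboundary p).

Definition cohom_class p (z : submod_type (cocycle p)) : cohom p :=
  \pi_(quotmod (coboundary p)) z.

(* Extended naturals and extended integers live in \bar int.  The set below
   contains 0 and is closed under suprema, so its supremum is its maximum. *)
Definition depth : \bar int :=
  supremum 0%E [set p : \bar int | (0 <= p)%E /\
    forall i : nat, ((i%:Z)%:E < p)%E -> forall h : cohom i, h = 0].

End Cech.

Lemma cech_dd (A : comPzRingType) (I : fg_ideal A) (N : lmodType A)
  (c : cech I N) : cech_d (cech_d c) = 0.
Proof.
apply: functional_extensionality_dep => J; rewrite -[RHS]/0.
pose s (K : {set 'I_(fg_num I)}) (j : 'I_(fg_num I)) : A :=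
    (-1) ^+ #|[set i in K | (i < j)%N]|.
pose G j k := loc_map (I j) (cech_prod J)
  (loc_map (I k) (cech_prod (J :\ j)) (c (J :\ j :\ k))).
pose F j k := (s J j * s (J :\ j) k) *: G j k.
have map0 (f b g : A) : g = f * b -> loc_map b g (0 : loc N f) = 0.
  by move=> gE; rewrite -(frac0 N f 0) loc_mapE // scaler0 frac0.
have -> : cech_d (cech_d c) J = \sum_(j in J) \sum_(k in J | k != j) F j k.
  rewrite [LHS]/cech_d; apply: eq_bigr => j jJ.
  have Jj := cech_prodD1 jJ.
  rewrite [cech_d c _]/cech_d.
  have mapD : {morph @loc_map A N (cech_prod (J :\ j)) (I j) (cech_prod J) :
      x y / x + y}.
    by move=> x y; have := @loc_map_linear _ N _ _ _ 1 x y Jj; rewrite !scale1r.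
  rewrite (big_morph _ mapD (map0 _ _ _ Jj)).
  rewrite scaler_sumr; apply: eq_big => [k|k _].
    by rewrite in_setD1 andbC.
  rewrite /F -scalerA; congr (_ *: _).
  have := @loc_map_linear _ N _ _ _ (s (J :\ j) k)
    (loc_map (I k) (cech_prod (J :\ j)) (c (J :\ j :\ k))) 0 Jj.
  by rewrite addr0 (map0 _ _ _ Jj) addr0.
have GC j k : j \in J -> k \in J -> k != j -> G j k = G k j.
  move=> jJ kJ kj; rewrite /G.
  have kJj : k \in J :\ j by rewrite in_setD1 kj.
  have jJk : j \in J :\ k by rewrite in_setD1 eq_sym kj.
  have KE : J :\ k :\ j = J :\ j :\ k by apply/setP=> i; rewrite !inE andbCA.
  have e1 := cech_prodD1 jJ; have e2 := cech_prodD1 kJj.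
  have e3 := cech_prodD1 kJ; have e4 := cech_prodD1 jJk.
  move: KE e2 e4; move: (J :\ k :\ j) (J :\ j :\ k) => K K' -> e2 e4.
  elim/frac_ind: (c K') => m l.
  by rewrite !loc_mapE // !scalerA mulrC.
have sE j k : j \in J -> k \in J -> (k < j)%N ->
    s J j * s (J :\ j) k = - (s J k * s (J :\ k) j).
  move=> jJ kJ kj.
  have -> : s (J :\ j) k = s J k.
    congr (_ ^+ _); apply: eq_card => i; rewrite !inE.
    case: (ltnP i k) => ik; rewrite ?andbF // !andbT.
    have -> : i != j by rewrite -val_eqE /=; lia.
    by [].
  rewrite {1}/s (cardsD1 k) !inE kJ kj /= exprD expr1 mulN1r mulNr mulrC.
  congr (- (_ * _)); congr (_ ^+ _); apply: eq_card => i; rewrite !inE.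
  by rewrite andbA.
have FC j k : j \in J -> k \in J -> (k < j)%N -> F j k = - F k j.
  move=> jJ kJ kj; rewrite /F sE // scaleNr GC //.
  by rewrite -val_eqE /=; lia.
rewrite (eq_bigr (fun j : 'I_(fg_num I) => \sum_(k in J | (k < j)%N) F j k +
  \sum_(k in J | (j < k)%N) F j k)); last first.
  move=> j jJ; rewrite (bigID (fun k : 'I_(fg_num I) => (k < j)%N)) /=.
  congr (_ + _);
    by apply: eq_bigl => k; rewrite -val_eqE /=; case: (k \in J) => //=; lia.
rewrite big_split /=.
rewrite [X in _ + X](exchange_big_dep (mem J)) /=; last first.
  by move=> ? ? ? /andP[].
rewrite -big_split big1 //= => j jJ.
under [X in _ + X]eq_bigl do rewrite jJ /=.
rewrite -big_split big1 //= => k /andP[kJ kj].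
by rewrite FC // addNr.
Qed.

(** * Standard graded algebras and graded modules *)

(* V is the internal direct sum of the F i. *)
Definition internal_direct_sum (T : choiceType) (V : zmodType)
  (F : T -> set V) : Prop :=
  (forall v, exists (s : seq T) (w : T -> V),
     (forall i, F i (w i)) /\ v = \sum_(i <- s) w i) /\
  (forall (s : seq T) (w : T -> V), uniq s -> (forall i, F i (w i)) ->
     \sum_(i <- s) w i = 0 -> forall i, i \in s -> w i = 0).

Record std_graded_algebra (R : comPzRingType) := StdGradedAlgebra {
  gr_ring :> comPzRingType;
  gr_map : {rmorphism R -> gr_ring};
  gr_comp : nat -> submodule (restrict gr_map (gr_ring^o));
  gr_direct : internal_direct_sum (fun mu => sm_set (gr_comp mu));
  gr_mul : forall mu nu (s t : gr_ring),
    gr_comp mu s -> gr_comp nu t -> gr_comp (mu + nu)%N (s * t);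
  (* S_0 = R *)
  gr_map_inj : injective gr_map;
  gr_comp0 : sm_set (gr_comp 0) = range gr_map;
  (* finitely many elements of S_1 generate S as an R-algebra *)
  gr_num : nat;
  gr_gen : 'I_gr_num -> gr_ring;
  gr_gen1 : forall i, gr_comp 1 (gr_gen i);
  gr_generated : forall B : {pred gr_ring}, subring_closed B ->
    (forall r, gr_map r \in B) -> (forall i, gr_gen i \in B) ->
    forall s, s \in B
}.

Record graded_module (R : comPzRingType) (S : std_graded_algebra R) :=
  GradedModule {
  gm_sort :> lmodType S;
  gm_comp : int -> submodule (restrict (gr_map S) gm_sort);
  gm_direct : internal_direct_sum (fun mu => sm_set (gm_comp mu));
  gm_scale : forall (mu : nat) (nu : int) (s : S) (m : gm_sort),
    gr_comp S mu s -> gm_comp nu m -> gm_comp (mu%:Z + nu) (s *: m)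
}.

Section Irrelevant.
Variables (R : comPzRingType) (S : std_graded_algebra R).

(* The ideal S_+, presented by the degree 1 generators of the algebra. *)
Definition irrelevant_ideal : fg_ideal S := FgIdeal (@gr_gen R S).

Definition positive_part : set S :=
  [set s | exists t : seq (nat * S),
     (forall x, x \in t -> (0 < x.1)%N /\ gr_comp S x.1 x.2) /\
     s = \sum_(x <- t) x.2].

Lemma irrelevant_idealE : fg_ideal_set irrelevant_ideal = positive_part.
Proof.
have P0 : positive_part 0 by exists [::]; split=> //; rewrite big_nil.
have PD s t : positive_part s -> positive_part t -> positive_part (s + t).
  move=> [u [uP ->]] [v [vP ->]]; exists (u ++ v).
  split; last by rewrite big_cat.
  by move=> x; rewrite mem_cat => /orP[/uP|/vP].
have [decomp free] := gr_direct S.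
have IP (s : S) : fg_ideal_set irrelevant_ideal s -> positive_part s.
  move=> [c ->]; apply: (big_ind positive_part) => // i _ /=.
  have [u [w [wP ->]]] := decomp (c i).
  exists [seq ((mu + 1)%N, w mu * gr_gen i) | mu <- u]; split.
    move=> _ /mapP[mu _ ->]; split; first by rewrite addn1.
    by apply: gr_mul => //; exact: gr_gen1.
  by rewrite big_map mulr_suml.
apply/seteqP; split=> s; first exact: IP.
pose I := fg_ideal_set irrelevant_ideal.
have I0 : I 0 by exists (fun=> 0); rewrite big1 // => i _; rewrite mul0r.
have IB (a x y : S) : I x -> I y -> I (x - a * y) := @fg_idealB _ _ a x y.
have IM (a y : S) : I y -> I (a * y).
  by move=> Iy; have := IB (- a) 0 y I0 Iy; rewrite sub0r mulNr opprK.
have ID (x y : S) : I x -> I y -> I (x + y).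
  by move=> Ix Iy; have := IB (-1) x y Ix Iy; rewrite mulN1r opprK.
pose B : {pred S} := fun s => `[< exists r, I (s - gr_map S r) >].
have BE x : reflect (exists r, I (x - gr_map S r)) (x \in B) by exact: asboolP.
have BT x : x \in B.
  apply: gr_generated.
  - split; first by apply/BE; exists 1; rewrite rmorph1 subrr.
    + move=> y z /BE[r Iy] /BE[r' Iz]; apply/BE; exists (r - r').
      have := IB 1 _ _ Iy Iz; rewrite mul1r rmorphB.
      by congr (I _); ring.
    + move=> y z /BE[r Iy] /BE[r' Iz]; apply/BE; exists (r * r').
      have := ID _ _ (IM z _ Iy) (IM (gr_map S r) _ Iz); rewrite rmorphM.
      by congr (I _); ring.
  - by move=> r; apply/BE; exists r; rewrite subrr.
  - move=> i; apply/BE; exists 0; rewrite rmorph0 subr0.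
    exists (fun j => (j == i)%:R); rewrite (bigD1 i) //= eqxx mul1r.
    by rewrite big1 ?addr0 // => j /negPf ->; rewrite mul0r.
have PN x : positive_part x -> positive_part (- x).
  move=> [t [tP ->]]; exists [seq (u.1, - u.2) | u <- t]; split.
    move=> _ /mapP[u /tP[u0 Su] ->]; split=> //=.
    by apply/sm_predP; rewrite rpredN; apply/sm_predP.
  by rewrite big_map sumrN.
have S0P (x : S) : gr_comp S 0 x -> positive_part x -> x = 0.
  move=> S0x [t [tP xE]]; pose D := undup [seq u.1 | u <- t].
  pose w nu : S := if nu == 0%N then - x else \sum_(u <- t | u.1 == nu) u.2.
  have D0 : 0%N \notin D.
    by rewrite mem_undup; apply/mapP => -[u /tP[+ _] u0]; rewrite -u0.
  have wP nu : gr_comp S nu (w nu).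
    rewrite /w; case: eqVneq => [->|_].
      by apply/sm_predP; rewrite rpredN; apply/sm_predP.
    rewrite big_seq_cond; apply/sm_predP; apply: rpred_sum => u.
    by move=> /andP[/tP[_ Su] /eqP <-]; apply/sm_predP.
  suff w0 : \sum_(nu <- 0%N :: D) w nu = 0.
    have /= := free (0%N :: D) w _ wP w0 0%N (mem_head _ _).
    rewrite D0 undup_uniq => /(_ isT) /eqP.
    by rewrite /w eqxx oppr_eq0 => /eqP.
  rewrite big_cons {1}/w eqxx; apply/eqP; rewrite addrC subr_eq0; apply/eqP.
  rewrite [RHS]xE big_seq (eq_bigr (fun nu => \sum_(u <- t | u.1 == nu) u.2)).
    rewrite -big_seq (exchange_big_dep predT) //= big_seq [RHS]big_seq.
    apply: eq_bigr => u ut; under eq_bigl do rewrite eq_sym.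
    rewrite -big_filter filter_pred1_uniq ?undup_uniq ?big_seq1 //.
    by rewrite mem_undup map_f.
  by move=> nu nuD; rewrite /w; case: eqVneq nuD D0 => // -> ->.
move=> Ps; have /BE[r Ir] := BT s.
suff r0 : gr_map S r = 0 by rewrite r0 subr0 in Ir.
apply: S0P; first by rewrite gr_comp0; exists r.
have -> : gr_map S r = s + - (s - gr_map S r) by ring.
by apply: PD => //; apply: PN; apply: IP.
Qed.

End Irrelevant.

Section Graded.
Variables (R : comPzRingType) (S : std_graded_algebra R) (M : graded_module S).

(* M_mu as an R-module. *)
Definition component (mu : int) : lmodType R := submod_type (gm_comp M mu).

(* Finite sums of elements of the M_nu with nu > r. *)
Definition above_set (r : \bar int) : set (restrict (gr_map S) M) :=
  [set m | exists s : seq (int * restrict (gr_map S) M),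
     (forall x, x \in s -> (r < x.1%:E)%E /\ gm_comp M x.1 x.2) /\
     m = \sum_(x <- s) x.2].

Lemma above_closed r : submod_closed (mem (above_set r)).
Proof.
apply: sm_closedP; first by exists [::]; split=> //; rewrite big_nil.
move=> a u v [s [sP ->]] [s' [s'P ->]].
exists ([seq (x.1, a *: x.2) | x <- s] ++ s'); split.
  move=> x; rewrite mem_cat => /orP[/mapP[y ys ->]|]; last exact: s'P.
  have [ry My] := sP y ys; split=> //=.
  by apply/sm_predP; rewrite rpredZ //; apply/sm_predP.
by rewrite big_cat big_map scaler_sumr.
Qed.

(* M_{>r} as an R-module. *)
Definition above (r : \bar int) : lmodType R :=
  submod_type (Submodule (above_closed r)).

(* Each generator of the irrelevant ideal has degree 1, so the product of
   those indexed by J has degree #|J|. *)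
Definition loc_comp (J : {set 'I_(gr_num S)}) (mu : int) :
  set (loc M (cech_prod (I := irrelevant_ideal S) J)) :=
  [set x | exists (m : M) (k : nat),
     gm_comp M (mu + (k * #|J|)%:Z) m /\ x = frac _ m k].

(* The degree mu part of H^p_{S_+}(M): classes of the cocycles whose components
   are all homogeneous of degree mu. *)
Definition cohom_comp (p : nat) (mu : int) :
  set (cohom (irrelevant_ideal S) M p) :=
  [set h | exists z : submod_type (cocycle (irrelevant_ideal S) M p),
     (forall J, loc_comp (J := J) mu (val z J)) /\ h = cohom_class z].

Definition reg : \bar int :=
  supremum -oo%E [set mu%:E | mu in
    [set mu : int | exists (i : nat) (h : cohom (irrelevant_ideal S) M i),
       cohom_comp (mu - i%:Z) h /\ h <> 0]].

End Graded.

(* Main.v *)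
From mathcomp Require Import all_boot all_order all_algebra.
From mathcomp Require Import zify ring.
From mathcomp Require Import boolp classical_sets constructive_ereal.
Require Import Defs.

(** Let x_1, ..., x_n be the generators of S_+ and x_J the product of the x_i
with i in J.  Fix a degree nu > r.  Then H^i_{S_+}(M)_nu = 0 for all i: below
depth_{S_+}(M) the whole module vanishes, and from there on nu + i > reg(M)
([cohom_comp_eq0]).  Therefore the degree nu part of the Cech complex of M,

    0 -> M_nu -> E^1 -> E^2 -> ...,  E^p = sum over |J| = p of (M_{x_J})_nu,

is an exact complex of R-modules.  Write Z^p for the kernel of E^p -> E^{p+1}.

Suppose that H^j_I(M_nu') = 0 for all nu' >= nu and j < d.  The module
(M_{x_J})_nu is the colimit of the M_{nu + k|J|} along multiplication by x_J,
and Cech cohomology commutes with such colimits, so H^j_I(E^p) = 0 for j < d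
([acyclic_colimit], [loc_sub_acyclic]).  The sequences
0 -> Z^p -> E^p -> Z^{p+1} -> 0 then yield H^j_I(Z^p) = 0 for j < d and p >= 1
by induction on j ([coboundary_of_short_exact], [cocycle_sub_acyclic]).  From
0 -> M_nu -> E^1 -> Z^2 -> 0 and H^{d-1}_I(Z^2) = 0 it follows that
H^d_I(M_nu) -> H^d_I(E^1) is injective.  The component of this map at x_i
factors through multiplication by x_i, that is, through H^d_I(M_{nu+1}).  So
H^d_I(M_{nu+1}) = 0 forces H^d_I(M_nu) = 0 ([component_acyclic]).

Taking for d the least depth of the M_nu with nu > r, this says that the value d
propagates from nu to nu + 1 ([depth_component_succ]).  Finally M_{>r} is the
direct sum of the M_nu with nu > r, so its H^j_I vanishes exactly when all the
H^j_I(M_nu) do ([above_acyclic], [component_acyclic_above]).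

This dimension shifting plays the role of the comparison of the two spectral
sequences of the double complex built from I and S_+. *)

Set Implicit Arguments.
Unset Strict Implicit.
Unset Printing Implicit Defensive.

Import Order.TTheory GRing.Theory Num.Theory.

Local Open Scope classical_set_scope.
Local Open Scope ring_scope.

(** * Functoriality of the Cech complex *)

Section LinearFunction.
Variables (A : comPzRingType) (N N' : lmodType A) (f : N -> N').
Hypothesis fL : linear f.

Lemma linf0 : f 0 = 0.
Proof. by have := fL (-1) 0 0; rewrite scaler0 addr0 scaleN1r addNr. Qed.

Lemma linfD u v : f (u + v) = f u + f v.
Proof. by have := fL 1 u v; rewrite !scale1r. Qed.

Lemma linfZ a u : f (a *: u) = a *: f u.
Proof. by have := fL a u 0; rewrite linf0 !addr0. Qed.

Lemma linfB u v : f (u - v) = f u - f v.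
Proof. by rewrite linfD -scaleN1r linfZ scaleN1r. Qed.

Lemma linf_sum (T : Type) (s : seq T) (P : pred T) (F : T -> N) :
  f (\sum_(i <- s | P i) F i) = \sum_(i <- s | P i) f (F i).
Proof. exact: (big_morph f linfD linf0). Qed.

End LinearFunction.

Lemma linf_cst0 (A : comPzRingType) (N N' : lmodType A) :
  linear (fun _ : N => 0 : N').
Proof. by move=> a u v; rewrite scaler0 addr0. Qed.

Section LocFun.
Variables (A : comPzRingType) (N N' : lmodType A).

Definition loc_fun (f : N -> N') (a : A) (x : loc N a) : loc N' a :=
  frac a (f (repr x).1) (repr x).2.

Variables (f : N -> N').
Hypothesis fL : linear f.

Lemma loc_funE a m k : loc_fun f (frac a m k) = frac a (f m) k.
Proof.
have /fracP[e he] := frac_repr (frac a m k).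
by apply/fracP; exists e; rewrite -!(linfZ fL) -he.
Qed.

Lemma loc_fun_linear a : linear (@loc_fun f a).
Proof.
move=> c; elim/frac_ind=> m k; elim/frac_ind=> m' k'.
rewrite fracZ fracD !loc_funE fracZ fracD.
by rewrite (linfD fL) !(linfZ fL).
Qed.

Lemma loc_fun_map (a b g : A) (x : loc N a) : g = a * b ->
  loc_fun f (loc_map b g x) = loc_map b g (loc_fun f x).
Proof.
move=> gE; elim/frac_ind: x => m k.
by rewrite loc_mapE // !loc_funE loc_mapE // (linfZ fL).
Qed.

(** The kernel of a localized map is the localization of the kernel. *)
Lemma loc_fun_eq0 a m k :
  loc_fun f (frac a m k) = 0 -> exists e, f (a ^+ e *: m) = 0.
Proof.
rewrite loc_funE -(frac0 _ _ 0) => /fracP[e]; rewrite scaler0 addn0 => he.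
by exists e; rewrite (linfZ fL).
Qed.

End LocFun.

Arguments loc_fun_linear [A N N' f] fL a _ _ _.

(** * Acyclicity of the Cech complex *)

Section CechFun.
Variables (A : comPzRingType) (I : fg_ideal A).

Definition cech_fun (N N' : lmodType A) (f : N -> N') (c : cech I N) :
  cech I N' := fun J => loc_fun f (c J).

(** The vanishing of [cohom I N j] (see [acyclicP]), in the form in which it is
used: it supplies a primitive for each cocycle. *)
Definition acyclic (N : lmodType A) (j : nat) : Prop :=
  forall z : cech I N, cocycle_set j z -> coboundary_set j z.

Lemma cohom_class_eq0 (N : lmodType A) j (z : submod_type (cocycle I N j)) :
  cohom_class z = 0 <-> coboundary_set j (val z).
Proof.
have := rwP (qpiP (coboundary I N j) z 0); rewrite subr0 => pi_eq0.
exact: iff_trans pi_eq0 (iff_sym (rwP (sm_predP (coboundary I N j) z))).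
Qed.

Lemma acyclicP (N : lmodType A) j :
  (forall h : cohom I N j, h = 0) <-> acyclic N j.
Proof.
split=> [h0 z zc|Nj].
  have zP : z \in sm_pred (cocycle I N j) by apply/sm_predP.
  exact: (cohom_class_eq0 (SubmodType zP)).1 (h0 _).
elim/quot_ind=> z; apply/cohom_class_eq0/Nj.
exact/(sm_predP (cocycle I N j))/valP.
Qed.

Section Fun.
Variables (N N' : lmodType A) (f : N -> N').
Hypothesis fL : linear f.

Lemma cech_fun_linear : linear (cech_fun f).
Proof.
by move=> a c c'; apply: functional_extensionality_dep => J;
  exact: loc_fun_linear.
Qed.

Lemma cech_funJ0 (c : cech I N) J : c J = 0 -> cech_fun f c J = 0.
Proof. by rewrite /cech_fun => ->; exact: linf0 (loc_fun_linear fL _). Qed.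

Lemma cech_fun_degree j c :
  in_cech_degree j c -> in_cech_degree j (cech_fun f c).
Proof. by move=> cj J Jj; apply/cech_funJ0/cj. Qed.

Lemma cech_fun_d c : cech_fun f (cech_d c) = cech_d (cech_fun f c).
Proof.
apply: functional_extensionality_dep => J.
rewrite /cech_fun /cech_d (linf_sum (loc_fun_linear fL _)).
apply: eq_bigr => j jJ; rewrite (linfZ (loc_fun_linear fL _)).
by rewrite loc_fun_map //; exact: cech_prodD1.
Qed.

Lemma cech_fun_cocycle j z : cocycle_set j z -> cocycle_set j (cech_fun f z).
Proof.
move=> [zj dz]; split; first exact: cech_fun_degree.
by rewrite -cech_fun_d dz; exact: linf0 cech_fun_linear.
Qed.

Lemma cech_fun_coboundary j z :
  coboundary_set j z -> coboundary_set j (cech_fun f z).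
Proof.
move=> [b [bj ->]]; exists (cech_fun f b); split; last exact: cech_fun_d.
by move=> J Jj; apply/cech_funJ0/bj.
Qed.

End Fun.

Lemma eq_cech_fun (N N' : lmodType A) (f g : N -> N') :
  f =1 g -> cech_fun f =1 cech_fun g.
Proof. by move=> /funext ->. Qed.

Lemma cech_fun_comp (N N' N'' : lmodType A) (g : N' -> N'') (f : N -> N') :
  linear g -> linear f ->
  cech_fun (g \o f) =1 cech_fun g \o cech_fun f.
Proof.
move=> gL fL c; apply: functional_extensionality_dep => J.
rewrite /= /cech_fun; elim/frac_ind: (c J) => m k.
rewrite !loc_funE // => a u v /=.
by rewrite fL gL.
Qed.

Lemma cech_fun_id (N : lmodType A) (c : cech I N) : cech_fun id c = c.
Proof.
apply: functional_extensionality_dep => J; rewrite /cech_fun.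
by elim/frac_ind: (c J) => m k; rewrite loc_funE.
Qed.

Lemma cech_fun0 (N N' : lmodType A) (c : cech I N) :
  cech_fun (fun _ => 0 : N') c = 0.
Proof.
apply: functional_extensionality_dep => J; rewrite /cech_fun.
elim/frac_ind: (c J) => m k; by rewrite loc_funE ?frac0 //; exact: linf_cst0.
Qed.

Lemma coboundaryD (N : lmodType A) j (z z' : cech I N) :
  coboundary_set j z -> coboundary_set j z' -> coboundary_set j (z + z').
Proof.
move=> [b [bj ->]] [b' [b'j ->]]; exists (b + b'); split; last first.
  by have := cech_d_linear 1 b b'; rewrite !scale1r => ->.
by move=> J Jj; rewrite -[LHS]/(b J + b' J) bj // b'j // addr0.
Qed.

Lemma coboundary0 (N : lmodType A) j : coboundary_set j (0 : cech I N).
Proof. by exists 0; split=> //; rewrite cech_d0. Qed.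

Lemma coboundary_sum (N : lmodType A) j (T : Type) (s : seq T) (P : pred T)
  (F : T -> cech I N) : (forall i, P i -> coboundary_set j (F i)) ->
  coboundary_set j (\sum_(i <- s | P i) F i).
Proof.
move=> FP; apply: (big_ind (coboundary_set j)) => //; first exact: coboundary0.
by move=> x y; exact: coboundaryD.
Qed.

Lemma sum_linear (N N' : lmodType A) (T : Type) (s : seq T) (P : pred T)
  (F : T -> N -> N') : (forall i, P i -> linear (F i)) ->
  linear (fun u => \sum_(i <- s | P i) F i u).
Proof.
move=> FL a u v; rewrite scaler_sumr -big_split.
by apply: eq_bigr => i Pi; exact: FL.
Qed.

Lemma cech_sumE (N : lmodType A) (T : Type) (s : seq T) (P : pred T)
  (F : T -> cech I N) J :
  (\sum_(i <- s | P i) F i) J = \sum_(i <- s | P i) F i J.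
Proof.
by rewrite (big_morph (fun x : cech I N => x J) (id1 := 0) (op1 := +%R)).
Qed.

Lemma cech_fun_sum (N N' : lmodType A) (T : Type) (s : seq T) (P : pred T)
  (F : T -> N -> N') (c : cech I N) : (forall i, P i -> linear (F i)) ->
  cech_fun (fun u => \sum_(i <- s | P i) F i u) c =
  \sum_(i <- s | P i) cech_fun (F i) c.
Proof.
move=> FL; apply: functional_extensionality_dep => J.
rewrite cech_sumE /cech_fun; elim/frac_ind: (c J) => m k.
rewrite loc_funE; last exact: sum_linear.
under [RHS]eq_bigr => i Pi do rewrite (loc_funE (FL i Pi)).
elim/big_rec2: _ => [|i x y Pi <-]; first by rewrite frac0.
rewrite fracD -scalerDr; apply/fracP; exists 0%N.
by rewrite scalerA -exprD; congr (_ ^+ _ *: _); lia.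
Qed.

(** Localization is exact, which lets one choose preimages fraction by
fraction. *)
Lemma cech_fun_exact (N N' N'' : lmodType A) (f : N -> N') (g : N' -> N'')
  (c : cech I N') : linear f -> linear g ->
  (forall u, g u = 0 -> exists v, f v = u) -> cech_fun g c = 0 ->
  exists b : cech I N, (forall J, c J = 0 -> b J = 0) /\ c = cech_fun f b.
Proof.
move=> fL gL ker_im gc.
have H J : exists x : loc N (cech_prod J),
    (c J = 0 -> x = 0) /\ c J = loc_fun f x.
  case: (EM (c J = 0)) => [->|nz].
    by exists 0; split=> //; rewrite (linf0 (loc_fun_linear fL _)).
  have : loc_fun g (c J) = 0 by have := congr1 (fun c : cech I N'' => c J) gc.
  elim/frac_ind: (c J) nz => m k nz /(loc_fun_eq0 gL)[e /ker_im[v vE]].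
  exists (frac _ v (e + k)); split=> //; rewrite loc_funE // vE.
  by apply/fracP; exists 0%N; rewrite scalerA -exprD; congr (_ ^+ _ *: _); lia.
exists (fun J => sval (cid (H J))); split=> [J|].
  by have [] := svalP (cid (H J)).
by apply: functional_extensionality_dep => J; have [] := svalP (cid (H J)).
Qed.

(** Part of the long exact sequence of cohomology: the kernel of
H^j(N) -> H^j(N') is the image of H^{j-1}(N''), so it vanishes with that
module, and it is zero for j = 0. *)
Lemma coboundary_of_short_exact (N N' N'' : lmodType A) (f : N -> N')
  (g : N' -> N'') j (z : cech I N) :
  linear f -> linear g -> injective f -> (forall u, g (f u) = 0) ->
  (forall u, g u = 0 -> exists v, f v = u) -> (forall w, exists u, g u = w) ->
  (forall i, j = i.+1 -> acyclic N'' i) ->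
  cocycle_set j z -> coboundary_set j (cech_fun f z) -> coboundary_set j z.
Proof.
move=> fL gL fI gf ker_im gS Nj zc [b [bj dbE]].
have cfI (c c' : cech I N) : cech_fun f c = cech_fun f c' -> c = c'.
  move=> cc'.
  have [] := @cech_fun_exact _ _ _ _ f (c - c') (@linf_cst0 A N N) fL.
  - move=> u u0; exists 0; apply: fI; rewrite u0.
    by rewrite (linf0 fL).
  - by rewrite (linfB (cech_fun_linear fL)) cc' subrr.
  by move=> d [_ /eqP]; rewrite cech_fun0 subr_eq0 => /eqP.
have gf0 (c : cech I N) : cech_fun g (cech_fun f c) = 0.
  by rewrite -[LHS](cech_fun_comp gL fL) (eq_cech_fun gf) cech_fun0.
(* It suffices to correct [b] by a coboundary so that it comes from [N]. *)
suff [b' [b'j gb' db']] : exists b' : cech I N',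
    [/\ forall J : {set 'I_(fg_num I)}, #|J|.+1 != j -> b' J = 0,
        cech_fun g b' = 0 & cech_d b' = cech_d b].
  have [a [aj aE]] := cech_fun_exact fL gL ker_im gb'.
  exists a; split; first by move=> J Jj; apply/aj/b'j.
  by apply: cfI; rewrite cech_fun_d // -aE db'.
case: j => [|i] in Nj zc bj dbE *.
  exists b; split=> //; apply: functional_extensionality_dep => J.
  exact/cech_funJ0/bj.
have [|c [cj gbE]] := Nj i erefl (cech_fun g b).
  split; first by move=> J Ji; apply/cech_funJ0/bj; rewrite // eqSS.
  by rewrite -cech_fun_d // -dbE gf0.
have [c' [c'j cE]] :=
  cech_fun_exact gL (@linf_cst0 A N'' N'') (fun w _ => gS w) (cech_fun0 _ c).
exists (b - cech_d c'); split.
- move=> J Ji; rewrite -[LHS]/(b J - cech_d c' J) bj // sub0r.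
  rewrite [cech_d c' J]big1 ?oppr0 // => k kJ.
  rewrite c'j; last first.
    by apply: cj; move: Ji; rewrite (cardsD1 k J) kJ add1n eqSS.
  by rewrite (linf0 (f := loc_map _ _)) ?scaler0 // => a x y;
    apply: loc_map_linear; exact: cech_prodD1.
- by rewrite (linfB (cech_fun_linear gL)) cech_fun_d // gbE cE subrr.
- by rewrite (linfB (f := @cech_d _ I N') (@cech_d_linear _ _ _)) cech_dd subr0.
Qed.

(** Used for maps that factor through a finite product of modules in which the
images of [z] are coboundaries. *)
Lemma coboundary_fun_sum (N N' : lmodType A) j (z : cech I N) (T : Type)
  (s : seq T) (P : pred T) (L : T -> lmodType A)
  (f : forall i, N -> L i) (g : forall i, L i -> N') :
  (forall i, P i -> linear (f i)) -> (forall i, P i -> linear (g i)) ->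
  (forall i, P i -> coboundary_set j (cech_fun (f i) z)) ->
  coboundary_set j (cech_fun (fun u => \sum_(i <- s | P i) g i (f i u)) z).
Proof.
move=> fL gL fz; rewrite cech_fun_sum => [|i Pi]; last first.
  by move=> a u v; rewrite (fL i Pi) (gL i Pi).
apply: coboundary_sum => i Pi; rewrite (cech_fun_comp (gL i Pi) (fL i Pi) z).
by apply: (cech_fun_coboundary (gL i Pi)); exact: fz.
Qed.

(** A cocycle of a colimit comes from a cochain of some stage, which becomes a
cocycle at a later stage: both hold because a cochain consists of finitely
many fractions. *)
Lemma acyclic_colimit (E : lmodType A) (N : nat -> lmodType A)
  (f : forall k, N k -> E) (t : forall k e, N k -> N (k + e)%N) j :
  (forall k, linear (f k)) -> (forall k e, linear (t k e)) ->
  (forall k e u, f (k + e)%N (t k e u) = f k u) ->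
  (forall k u, f k u = 0 ->
     exists e, forall e', (e <= e')%N -> t k e' u = 0) ->
  (forall w, exists k u, f k u = w) ->
  (forall k, acyclic (N k) j) -> acyclic E j.
Proof.
move=> fL tL ft ker_f fS Nj z [zj dz].
have lift k k' u : (k <= k')%N -> exists v, f k' v = f k u.
  by move=> kk'; rewrite -(subnKC kk'); exists (t k (k' - k)%N u); rewrite ft.
have num J : exists k, forall k', (k <= k')%N ->
    exists x : loc (N k') (cech_prod J),
      (z J = 0 -> x = 0) /\ loc_fun (f k') x = z J.
  case: (EM (z J = 0)) => [->|nz].
    exists 0%N => k _; exists 0; split=> //.
    exact: linf0 (loc_fun_linear (fL k) _).
  elim/frac_ind: (z J) nz => m l nz; have [k [u uE]] := fS m.
  exists k => k' /(@lift k k' u)[v]; rewrite uE => vE.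
  by exists (frac _ v l); split=> [/nz//|]; rewrite loc_funE // vE.
(* Finitely many [J]: conditions that hold at all late stages hold together
   at some stage. *)
have bound (P : {set 'I_(fg_num I)} -> nat -> Prop) :
    (forall J, exists k, forall k', (k <= k')%N -> P J k') ->
    exists k, forall J, P J k.
  move=> HP; exists (\max_J sval (cid (HP J))) => J.
  by apply: (svalP (cid (HP J))); exact: leq_bigmax.
have [k {}num] := bound _ num.
pose c : cech I (N k) := fun J => sval (cid (num J)).
have fc : cech_fun (f k) c = z.
  apply: functional_extensionality_dep => J.
  by have [] := svalP (cid (num J)).
have cj : in_cech_degree j c.
  by move=> J /zj; have [] := svalP (cid (num J)).
have [e ce] : exists e, forall J, loc_fun (t k e) (cech_d c J) = 0.
  apply: bound => J.
  have : loc_fun (f k) (cech_d c J) = 0.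
    by rewrite -[LHS]/(cech_fun (f k) (cech_d c) J) cech_fun_d // fc dz.
  elim/frac_ind: (cech_d c J) => m l /(loc_fun_eq0 (fL k))[a /ker_f[e te]].
  exists e => e' /te te'; rewrite loc_funE // -(frac0 _ _ 0).
  by apply/fracP; exists a; rewrite addn0 -(linfZ (tL k e')) te' scaler0.
have /Nj [b [bj bE]] : cocycle_set j (cech_fun (t k e) c).
  split; first exact: cech_fun_degree.
  rewrite -cech_fun_d //; exact: functional_extensionality_dep.
exists (cech_fun (f (k + e)%N) b); split.
  by move=> J /bj; exact: cech_funJ0.
rewrite -cech_fun_d // -bE -[RHS](cech_fun_comp (fL _) (tL _ _)) -fc.
by apply: eq_cech_fun => u /=; rewrite ft.
Qed.

End CechFun.

(** * Homogeneous components *)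

Section Submodule.
Variables (A : comPzRingType) (V : lmodType A) (W : submodule V).

Lemma sm_set0 : W 0.
Proof. by apply/sm_predP; exact: rpred0. Qed.

Lemma sm_setP a u v : W u -> W v -> W (a *: u + v).
Proof.
by move=> /sm_predP Wu /sm_predP Wv; apply/sm_predP; rewrite rpredD ?rpredZ.
Qed.

Lemma sm_setD u v : W u -> W v -> W (u + v).
Proof. by move=> Wu; rewrite -[u]scale1r; exact: sm_setP. Qed.

Lemma sm_setZ a u : W u -> W (a *: u).
Proof.
by move=> Wu; rewrite -[_ *: _]addr0; apply: sm_setP => //; exact: sm_set0.
Qed.

End Submodule.

(** The components of a vector are unique, hence depend linearly on it.  The
last clause lets several vectors be decomposed over a common set of indices. *)
Lemma internal_direct_sum_proj (A : comPzRingType) (V : lmodType A)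
  (T : choiceType) (F : T -> submodule V) :
  internal_direct_sum (fun i => sm_set (F i)) ->
  exists p : T -> V -> V,
    [/\ forall i, linear (p i), forall i v, F i (p i v),
        forall i j v, F j v -> p i v = if i == j then v else 0 &
        forall v, exists s : seq T, forall s', uniq s' -> {subset s <= s'} ->
          v = \sum_(i <- s') p i v].
Proof.
move=> [decomp free].
pose dec (v : V) (w : T -> V) (s : seq T) := (forall i, F i (w i)) /\
  forall s', uniq s' -> {subset s <= s'} -> v = \sum_(i <- s') w i.
have ex v : exists w s, dec v w s.
  have [s [w [wF vE]]] := decomp v.
  (* [s] may repeat an index, so that component counts with multiplicity. *)
  exists (fun i => w i *+ count_mem i s), s; split.
    by move=> i; rewrite -scaler_nat; exact: sm_setZ.
  move=> s' us' ss'; rewrite vE -big_undup_iterop_count.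
  rewrite [RHS](bigID (mem s)) /= [X in _ + X]big1 ?addr0; last first.
    by move=> i /count_memPn ->.
  rewrite -[RHS]big_filter (eq_bigr (fun i => w i *+ count_mem i s)) //.
  apply: perm_big; apply: uniq_perm; rewrite ?undup_uniq ?filter_uniq // => i.
  by rewrite mem_undup mem_filter; case: (boolP (i \in s)) => //= /ss'.
have uni v w w' s s' : dec v w s -> dec v w' s' -> w = w'.
  move=> [wF wE] [w'F w'E]; apply/funext => i; apply/eqP.
  rewrite -subr_eq0; apply/eqP.
  have u := undup_uniq (i :: s ++ s').
  apply: (free _ (fun i => w i - w' i) u).
  - by move=> k; rewrite addrC -scaleN1r; exact: sm_setP.
  - rewrite sumrB -w'E -?wE ?subrr // => k ks; rewrite mem_undup inE mem_cat ks;
      by rewrite ?orbT.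
  - by rewrite mem_undup mem_head.
pose p i v := sval (cid (ex v)) i.
have pP v : exists s, dec v (p ^~ v) s by exact: svalP (cid (ex v)).
exists p; split.
- move=> i a u v; have [s [uF uE]] := pP u; have [s' [vF vE]] := pP v.
  have [s'' auv] := pP (a *: u + v).
  suff /(uni _ _ _ _ _ auv)/(congr1 (@^~ i)) /= -> // :
    dec (a *: u + v) (fun k => a *: p k u + p k v) (s ++ s') by [].
  split=> [k|r ur sr].
    exact: sm_setP.
  have sv : {subset s' <= r} by move=> k ks; rewrite sr // mem_cat ks orbT.
  have su : {subset s <= r} by move=> k ks; rewrite sr // mem_cat ks.
  by rewrite {1}(uE r ur su) {1}(vE r ur sv) scaler_sumr -big_split.
- by move=> i v; have [s [pF _]] := pP v.
- move=> i j v Fv; have [s pv] := pP v.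
  suff /(uni _ _ _ _ _ pv)/(congr1 (@^~ i)) /= -> // :
    dec v (fun k => if k == j then v else 0) [:: j] by [].
  split=> [k|r ur jr].
    by case: eqVneq => [-> //|_]; exact: sm_set0.
  rewrite -big_mkcond -big_filter filter_pred1_uniq ?big_seq1 //.
  by apply: jr; rewrite mem_head.
- by move=> v; have [s [_ vE]] := pP v; exists s.
Qed.

Section GradedModule.
Variables (R : comPzRingType) (S : std_graded_algebra R) (M : graded_module S).

Definition gproj : int -> restrict (gr_map S) M -> restrict (gr_map S) M :=
  sval (cid (internal_direct_sum_proj (gm_direct M))).

Lemma gproj_linear mu : linear (gproj mu).
Proof. by rewrite /gproj; case: cid => p []. Qed.

Lemma gproj_comp mu m : gm_comp M mu (gproj mu m).
Proof. by rewrite /gproj; case: cid => p []. Qed.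

Lemma gproj_homogeneous mu nu m : gm_comp M nu m ->
  gproj mu m = if mu == nu then m else 0.
Proof. by rewrite /gproj; case: cid => p /= [_ _ ph _]; exact: ph. Qed.

Lemma gproj_sum m : exists s : seq int,
  forall s', uniq s' -> {subset s <= s'} -> m = \sum_(mu <- s') gproj mu m.
Proof. by rewrite /gproj; case: cid => p []. Qed.

Lemma gprojZ (d : nat) mu (s : S) (m : M) : gr_comp S d s ->
  gproj (d%:Z + mu) (s *: m : M) = (s *: (gproj mu m : M) : M).
Proof.
move=> ds; have [r /(_ (undup (mu :: r)))] := gproj_sum m.
rewrite undup_uniq => /(_ isT) mE.
have {1}-> : m = \sum_(nu <- undup (mu :: r)) gproj nu m.
  by apply: mE => k kr; rewrite mem_undup inE kr orbT.
rewrite [s *: _]scaler_sumr (linf_sum (gproj_linear _)).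
rewrite (bigD1_seq mu) ?mem_undup ?mem_head ?undup_uniq //=.
rewrite (gproj_homogeneous _ (gm_scale ds (gproj_comp mu m))) eqxx.
rewrite big1 ?addr0 // => nu nu_mu.
rewrite (gproj_homogeneous _ (gm_scale ds (gproj_comp nu m))).
by rewrite (inj_eq (addrI _)) eq_sym (negPf nu_mu).
Qed.

Lemma gr_compX (d k : nat) (s : S) :
  gr_comp S d s -> gr_comp S (k * d) (s ^+ k).
Proof.
move=> ds; elim: k => [|k IHk].
  by rewrite mul0n gr_comp0; exists 1; rewrite ?rmorph1.
by rewrite exprS mulSn; exact: gr_mul.
Qed.

Let irr := irrelevant_ideal S.
Implicit Types (J : {set 'I_(fg_num irr)}) (mu nu : int) (m : M).

Lemma gr_comp_cech_prod J : gr_comp S #|J| (cech_prod J).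
Proof.
rewrite /cech_prod -sum1_card.
elim/big_rec2: _ => [|j d s _ ds]; last by apply: gr_mul => //; exact: gr_gen1.
by rewrite gr_comp0; exists 1; rewrite ?rmorph1.
Qed.

Lemma loc_comp_closed J nu :
  submod_closed (V := restrict (gr_map S) (loc M (cech_prod J)))
    (mem (@loc_comp R S M J nu)).
Proof.
apply: (@sm_closedP R (restrict (gr_map S) (loc M (cech_prod J)))).
  exists 0, 0%N; split; last by rewrite frac0.
  exact: (sm_set0 (gm_comp M _)).
move=> a _ _ [m [k [mc ->]]] [m' [k' [mc' ->]]].
pose x : S := cech_prod J.
exists (x ^+ k' *: (gr_map S a *: m) + x ^+ k *: m'), (k + k')%N.
have Jk l := gr_compX l (gr_comp_cech_prod J).
have mc1 := sm_setZ a mc.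
split; last by rewrite -fracD -fracZ.
have := gm_scale (Jk k') mc1; have := gm_scale (Jk k) mc'.
rewrite !addrA ![_%:Z + nu]addrC -!addrA -!PoszD -!mulnDl [(k' + k)%N]addnC.
by move=> h' h; exact: (sm_setD h h').
Qed.

Definition loc_sub J nu :
  submodule (restrict (gr_map S) (loc M (cech_prod J))) :=
  Submodule (loc_comp_closed J nu).

Local Notation cfrac J := (@frac S M (cech_prod J)).

Definition loc_proj nu J (x : loc M (cech_prod J)) : loc M (cech_prod J) :=
  cfrac J (gproj (nu + ((repr x).2 * #|J|)%:Z) (repr x).1) (repr x).2.

(** The projection is independent of the fraction because [cech_prod J] is
homogeneous, of degree [#|J|]. *)
Lemma loc_projE nu J m k : loc_proj nu (cfrac J m k) =
  cfrac J (gproj (nu + (k * #|J|)%:Z) m) k.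
Proof.
have /fracP[e he] := frac_repr (cfrac J m k).
apply/fracP; exists e; move: (repr _) he => [n l] /= he.
have Jk i := gr_compX i (gr_comp_cech_prod J).
rewrite -(gprojZ _ _ (Jk (e + k)%N)) -(gprojZ _ _ (Jk (e + l)%N)) -he.
by congr gproj; rewrite !mulnDl !PoszD; ring.
Qed.

Lemma loc_proj_linear nu J :
  linear (loc_proj nu (J := J) :
    restrict (gr_map S) (loc M (cech_prod J)) ->
    restrict (gr_map S) (loc M (cech_prod J))).
Proof.
move=> a; elim/frac_ind=> m k; elim/frac_ind=> m' k'.
have Jk i := gr_compX i (gr_comp_cech_prod J).
rewrite -[a *: _]/(gr_map S a *: frac _ _ _) fracZ fracD !loc_projE.
rewrite -[a *: _]/(gr_map S a *: frac _ _ _) fracZ fracD.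
congr (frac _ _ _); rewrite (linfD (gproj_linear _)).
have aP mu : gproj mu (gr_map S a *: m : M) =
    (gr_map S a *: (gproj mu m : M) : M).
  exact: linfZ (gproj_linear mu) a m.
rewrite -aP -!(gprojZ _ _ (Jk _)).
by congr (gproj _ _ + gproj _ _); rewrite mulnDl !PoszD; ring.
Qed.

Lemma loc_proj_comp nu J (x : loc M (cech_prod J)) :
  loc_comp nu (loc_proj nu x).
Proof.
elim/frac_ind: x => m k; rewrite loc_projE.
by exists (gproj (nu + (k * #|J|)%:Z) m), k; split=> //; exact: gproj_comp.
Qed.

Lemma loc_proj_id nu J (x : loc M (cech_prod J)) :
  loc_comp nu x -> loc_proj nu x = x.
Proof.
move=> [m [k [mc ->]]].
by rewrite loc_projE (gproj_homogeneous _ mc) eqxx.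
Qed.

Lemma loc_proj_map nu J j (x : loc M (cech_prod (J :\ j))) : j \in J ->
  loc_proj nu (loc_map (irr j) (cech_prod J) x) =
  loc_map (irr j) (cech_prod J) (loc_proj nu x).
Proof.
move=> jJ; have Jj := cech_prodD1 jJ; elim/frac_ind: x => m k.
rewrite loc_mapE // !loc_projE loc_mapE //; congr frac.
rewrite -(gprojZ _ _ (gr_compX k (gr_gen1 j))).
by congr gproj; rewrite (cardsD1 j J) jJ; lia.
Qed.

Definition cech_proj nu (c : cech irr M) : cech irr M :=
  fun J => loc_proj nu (c J).

Lemma cech_proj_d nu c : cech_d (cech_proj nu c) = cech_proj nu (cech_d c).
Proof.
apply: functional_extensionality_dep => J; rewrite /cech_proj /cech_d.
rewrite (linf_sum (@loc_proj_linear nu J)); apply: eq_bigr => j jJ.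
rewrite -loc_proj_map // -(rmorph_sign (gr_map S)).
exact/esym/(linfZ (@loc_proj_linear nu J)).
Qed.

Definition homogeneous nu (c : cech irr M) : Prop :=
  forall J, loc_comp nu (c J).

Lemma homogeneous_d nu c : homogeneous nu c -> homogeneous nu (cech_d c).
Proof.
move=> cnu; have -> : c = cech_proj nu c.
  by apply: functional_extensionality_dep => J; rewrite /cech_proj loc_proj_id.
by rewrite cech_proj_d => J; exact: loc_proj_comp.
Qed.

(** A primitive of a homogeneous cocycle can be replaced by its homogeneous
component. *)
Lemma homogeneous_primitive nu p c :
  (forall h : cohom irr M p, cohom_comp nu h -> h = 0) ->
  cocycle_set p c -> homogeneous nu c ->
  exists b : cech irr M,
    [/\ forall J, #|J|.+1 != p -> b J = 0, homogeneous nu b &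
    c = cech_d b].
Proof.
move=> Hp cp cnu.
have zP : c \in sm_pred (cocycle irr M p) by apply/sm_predP.
have [|b [bp bE]] := (cohom_class_eq0 (SubmodType zP)).1.
  by apply: Hp; exists (SubmodType zP); split.
exists (cech_proj nu b); split.
- move=> J /bp; rewrite /cech_proj => ->.
  exact: linf0 (@loc_proj_linear nu J).
- by move=> J; exact: loc_proj_comp.
- rewrite cech_proj_d -bE.
  by apply: functional_extensionality_dep => J; rewrite /cech_proj loc_proj_id.
Qed.

Lemma cech_sub_closed p nu :
  submod_closed (V := restrict (gr_map S) (cech irr M))
    (mem [set c | in_cech_degree p c /\ homogeneous nu c]).
Proof.
apply: (@sm_closedP R (restrict (gr_map S) (cech irr M))).
  by split=> // J; exact: (sm_set0 (loc_sub J nu)).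
move=> a c c' [cp cnu] [cp' cnu']; split.
  exact: (in_cech_degree_linear (gr_map S a)).
by move=> J; exact: (sm_setP (W := loc_sub J nu) a (cnu J) (cnu' J)).
Qed.

(** The term of cohomological degree [p] of the degree [nu] part of the Cech
complex, written E^p above and below. *)
Definition cech_sub p nu : submodule (restrict (gr_map S) (cech irr M)) :=
  Submodule (cech_sub_closed p nu).

Lemma cocycle_sub_closed p nu :
  submod_closed (V := restrict (gr_map S) (cech irr M))
    (mem [set c | cocycle_set p c /\ homogeneous nu c]).
Proof.
apply: (@sm_closedP R (restrict (gr_map S) (cech irr M))).
  split; last by move=> J; exact: (sm_set0 (loc_sub J nu)).
  exact: (sm_set0 (cocycle irr M p)).
move=> a c c' [cp cnu] [cp' cnu']; split.
  exact: (sm_setP (W := cocycle irr M p) (gr_map S a)).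
by move=> J; exact: (sm_setP (W := loc_sub J nu) a (cnu J) (cnu' J)).
Qed.

(** The kernel Z^p of the differential of E^p. *)
Definition cocycle_sub p nu : submodule (restrict (gr_map S) (cech irr M)) :=
  Submodule (cocycle_sub_closed p nu).

End GradedModule.

(** * Acyclicity of the homogeneous parts *)

Section ToSub.
Variables (A : comPzRingType) (V : lmodType A).

(** Total, with value 0 outside [W], so that maps into a submodule can be
written without carrying proofs of membership. *)
Definition to_sub (W : submodule V) (v : V) : submod_type W := insubd 0 v.

Lemma to_subK (W : submodule V) v : W v -> val (to_sub W v) = v.
Proof. by move=> Wv; rewrite insubdK //; exact/sm_predP. Qed.

Lemma sm_set_val (W : submodule V) (u : submod_type W) : W (val u).
Proof. exact/sm_predP/valP. Qed.

Lemma val_sub_linear (W : submodule V) : linear (val : submod_type W -> V).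
Proof. by move=> a u v; rewrite linearP. Qed.

Lemma to_sub_linear (W : submodule V) (N : lmodType A) (f : N -> V) :
  linear f -> (forall u, W (f u)) -> linear (fun u => to_sub W (f u)).
Proof.
move=> fL Wf a u v; apply: val_inj; rewrite to_subK // fL.
by rewrite val_sub_linear !to_subK.
Qed.

End ToSub.

Section Acyclicity.
Variables (R : comPzRingType) (S : std_graded_algebra R) (M : graded_module S).
Variable (I : fg_ideal R).

Let irr := irrelevant_ideal S.
Implicit Types (J : {set 'I_(fg_num irr)}) (mu nu : int).

Local Notation cfrac J := (@frac S M (cech_prod J)).

Definition component_mul (s : S) mu mu' (m : component M mu) :
  component M mu' :=
  to_sub (gm_comp M mu') (s *: (val m : M)).

Lemma component_mulE (s : S) (d : nat) mu mu' (m : component M mu) :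
  gr_comp S d s -> mu' = d%:Z + mu ->
  val (component_mul s mu' m) = (s *: (val m : M) : M).
Proof.
by move=> ds ->; apply: to_subK; exact: gm_scale ds (sm_set_val m).
Qed.

Lemma component_mul_linear (s : S) (d : nat) mu mu' :
  gr_comp S d s -> mu' = d%:Z + mu ->
  linear (component_mul s mu' : component M mu -> _).
Proof.
move=> ds ->; apply: to_sub_linear => [a u v|u].
  rewrite val_sub_linear.
  rewrite -[LHS]/(s *: (gr_map S a *: (val u : M) + (val v : M))).
  by rewrite scalerDr !scalerA mulrC -scalerA.
exact: gm_scale ds (sm_set_val u).
Qed.

Definition component_frac J nu k (m : component M (nu + (k * #|J|)%:Z)) :
  submod_type (loc_sub M J nu) := to_sub (loc_sub M J nu) (cfrac J (val m) k).

Lemma component_fracE J nu k (m : component M (nu + (k * #|J|)%:Z)) :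
  val (component_frac m) = cfrac J (val m) k.
Proof. by apply: to_subK; exists (val m), k; split=> //; exact: sm_set_val. Qed.

Lemma component_frac_linear J nu k : linear (@component_frac J nu k).
Proof.
apply: to_sub_linear => [a u v|u]; last first.
  by exists (val u), k; split=> //; exact: sm_set_val.
rewrite val_sub_linear.
rewrite -[RHS]/(gr_map S a *: cfrac J (val u) k + cfrac J (val v) k).
rewrite fracZ fracD; apply/fracP; exists 0%N.
by rewrite -scalerDr scalerA -exprD.
Qed.

(** The degree [nu] part of M_{x_J} is the colimit of the M_{nu + k|J|}: the
[k]-th stage holds the fractions with denominator x_J ^ k. *)
Lemma loc_sub_acyclic J nu j :
  (forall k : nat, acyclic I (component M (nu + (k * #|J|)%:Z)) j) ->
  acyclic I (submod_type (loc_sub M J nu)) j.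
Proof.
have Jk i := gr_compX i (gr_comp_cech_prod J).
have deg k e : nu + ((k + e) * #|J|)%:Z =
    (e * #|J|)%:Z + (nu + (k * #|J|)%:Z).
  by rewrite mulnDl !PoszD; ring.
apply: (acyclic_colimit (f := @component_frac J nu)
  (t := fun k e => component_mul (cech_prod J ^+ e) _)).
- by move=> k; exact: component_frac_linear.
- by move=> k e; exact: (component_mul_linear (Jk e)).
- move=> k e u; apply: val_inj; rewrite !component_fracE.
  rewrite (component_mulE _ (Jk e)) //.
  by apply/fracP; exists 0%N; rewrite scalerA -exprD; congr (_ ^+ _ *: _); lia.
- move=> k u /(congr1 val); rewrite component_fracE => h.
  have /fracP[e] : cfrac J (val u) k = cfrac J 0 0 by rewrite h frac0.
  rewrite scaler0 addn0 => ue; exists e => e' ee'; apply: val_inj.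
  rewrite (component_mulE _ (Jk e')) // -(subnK ee') exprD -scalerA.
  by rewrite -[val u]/(val u : M) ue scaler0.
- move=> w; have [m [k [mc wE]]] := sm_set_val w.
  exists k, (to_sub (gm_comp M (nu + (k * #|J|)%:Z)) m); apply: val_inj.
  by rewrite component_fracE to_subK.
Qed.

Definition cech_single J (x : loc M (cech_prod J)) : cech irr M :=
  dfwith (fun K => 0 : loc M (cech_prod K)) x.

Lemma cech_single_sum p (c : cech irr M) : in_cech_degree p c ->
  c = \sum_(J : {set 'I_(fg_num irr)} | #|J| == p) cech_single (c J).
Proof.
move=> cp; apply: functional_extensionality_dep => K; rewrite cech_sumE.
have [Kp|Kp] := boolP (#|K| == p).
  rewrite (bigD1 K) //= /cech_single dfwith_in big1 ?addr0 // => J /andP[_ JK].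
  by rewrite dfwith_out.
rewrite cp // big1 // => J Jp; rewrite /cech_single dfwith_out //.
by apply: contraNneq Kp => <-.
Qed.

Lemma cech_single_sub J nu (x : submod_type (loc_sub M J nu)) :
  cech_sub M #|J| nu (cech_single (val x)).
Proof.
split=> [K KJ|K]; rewrite /cech_single; last first.
  have [<-|JK] := eqVneq J K; first by rewrite dfwith_in; exact: (sm_set_val x).
  by rewrite dfwith_out //; exact: (sm_set0 (loc_sub M K nu)).
by rewrite dfwith_out //; apply: contraNneq KJ => ->.
Qed.

Definition single_sub p J nu (x : submod_type (loc_sub M J nu)) :
  submod_type (cech_sub M p nu) :=
  to_sub (cech_sub M p nu) (cech_single (val x)).

Lemma single_sub_linear p J nu : #|J| == p -> linear (@single_sub p J nu).
Proof.
move=> /eqP <-; apply: to_sub_linear => [a u v|u]; last exact: cech_single_sub.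
apply: functional_extensionality_dep => K.
rewrite val_sub_linear.
rewrite -[RHS]/(gr_map S a *: cech_single (val u) K + cech_single (val v) K).
rewrite /cech_single; have [<-|JK] := eqVneq J K; first by rewrite !dfwith_in.
by rewrite !dfwith_out // scaler0 addr0.
Qed.

Lemma single_sub_sum p nu (u : submod_type (cech_sub M p nu))
  (v : forall J, submod_type (loc_sub M J nu)) :
  (forall J, #|J| = p -> val (v J) = (val u : cech irr M) J) ->
  u = \sum_(J : {set 'I_(fg_num irr)} | #|J| == p) single_sub p (v J).
Proof.
move=> uv; apply: val_inj; rewrite (linf_sum (@val_sub_linear _ _ _)).
have [up _] := sm_set_val u; rewrite {1}(cech_single_sum up).
apply: eq_bigr => J /eqP Jp.
have vJ := cech_single_sub (v J); rewrite Jp in vJ.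
by rewrite to_subK // uv.
Qed.

(** E^p is the product of the (M_{x_J})_nu with |J| = p. *)
Lemma cech_sub_acyclic p nu j :
  (forall J, #|J| = p -> acyclic I (submod_type (loc_sub M J nu)) j) ->
  acyclic I (submod_type (cech_sub M p nu)) j.
Proof.
move=> Jacyc z zc.
pose f J (u : submod_type (cech_sub M p nu)) :=
  to_sub (loc_sub M J nu) ((val u : cech irr M) J).
have homu J (u : submod_type (cech_sub M p nu)) :
  loc_sub M J nu ((val u : cech irr M) J) by have [_ /(_ J)] := sm_set_val u.
have fL J : linear (f J).
  apply: to_sub_linear => [a u v|u]; last exact: homu.
  by rewrite val_sub_linear.
rewrite -[z]cech_fun_id (eq_cech_fun (g := fun u =>
  \sum_(J : {set 'I_(fg_num irr)} | #|J| == p) single_sub p (f J u))).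
  apply: (@coboundary_fun_sum _ _ _ _ _ _ _ _ _ _ f
    (fun J => @single_sub p J nu)) => J Jp.
  - exact: fL.
  - exact: single_sub_linear.
  - by apply: (Jacyc J (eqP Jp)); exact: (cech_fun_cocycle (fL J) zc).
by move=> u; apply: single_sub_sum => J _; rewrite to_subK.
Qed.

Section Vanishing.
Variable nu : int.
Hypothesis vanish :
  forall p (h : cohom irr M p), cohom_comp nu h -> h = 0.

Definition sub_d p (c : submod_type (cech_sub M p nu)) :
  submod_type (cocycle_sub M p.+1 nu) :=
  to_sub (cocycle_sub M p.+1 nu) (cech_d (val c : cech irr M)).

Lemma cech_d_cocycle_sub p (c : submod_type (cech_sub M p nu)) :
  cocycle_sub M p.+1 nu (cech_d (val c : cech irr M)).
Proof.
have [cp cnu] := sm_set_val c.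
split; last exact: homogeneous_d.
split; last exact: cech_dd.
move=> J Jp; rewrite [LHS]big1 // => j jJ.
rewrite (cp (J :\ j)); last first.
  by apply: contraNneq Jp => <-; rewrite (cardsD1 j J) jJ.
rewrite (linf0 (f := loc_map _ _)) ?scaler0 // => a x y.
by apply: loc_map_linear; exact: cech_prodD1.
Qed.

Lemma sub_d_linear p : linear (@sub_d p).
Proof.
apply: to_sub_linear => [a u v|]; last exact: cech_d_cocycle_sub.
rewrite val_sub_linear.
exact: cech_d_linear (gr_map S a) (val u : cech irr M) (val v : cech irr M).
Qed.

(** Exactness of the Cech complex in degree [nu], by the vanishing of its
cohomology there. *)
Lemma sub_d_surj p (w : submod_type (cocycle_sub M p.+1 nu)) :
  exists c, @sub_d p c = w.
Proof.
have [wc wnu] := sm_set_val w.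
have [b [bp bnu wE]] := homogeneous_primitive (@vanish p.+1) wc wnu.
exists (to_sub (cech_sub M p nu) b); apply: val_inj.
have bE : val (to_sub (cech_sub M p nu) b) = b.
  by apply: to_subK; split.
by rewrite to_subK ?bE //; rewrite -wE; split.
Qed.

Definition cocycle_incl p (z : submod_type (cocycle_sub M p nu)) :
  submod_type (cech_sub M p nu) := to_sub (cech_sub M p nu) (val z).

Lemma cocycle_inclE p z : val (@cocycle_incl p z) = val z.
Proof. by have [[zp _] znu] := sm_set_val z; exact: to_subK. Qed.

Lemma cocycle_incl_linear p : linear (@cocycle_incl p).
Proof.
apply: to_sub_linear => [a u v|u]; first by rewrite val_sub_linear.
by have [[zp _] znu] := sm_set_val u.
Qed.

(** Dimension shifting along 0 -> Z^p -> E^p -> Z^{p+1} -> 0: the vanishing in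
degree j for Z^p follows from that in degree j for E^p and in degree j - 1 for
Z^{p+1}. *)
Lemma cocycle_sub_acyclic d :
  (forall (k : nat) j, (j < d)%N -> acyclic I (component M (nu + k%:Z)) j) ->
  forall j p, (j < d)%N -> (0 < p)%N ->
  acyclic I (submod_type (cocycle_sub M p nu)) j.
Proof.
move=> Md; elim/ltn_ind=> j IHj p jd p0 z zc.
apply: (coboundary_of_short_exact (@cocycle_incl_linear p) (@sub_d_linear p))
  (zc) _.
- by move=> u v uv; apply: val_inj; rewrite -!cocycle_inclE uv.
- move=> u; apply: val_inj; rewrite to_subK; last exact: cech_d_cocycle_sub.
  by rewrite cocycle_inclE; have [[]] := sm_set_val u.
- move=> u /(congr1 val); rewrite to_subK; last exact: cech_d_cocycle_sub.
  move=> du; have [up unu] := sm_set_val u.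
  exists (to_sub (cocycle_sub M p nu) (val u)); apply: val_inj.
  by rewrite cocycle_inclE to_subK.
- exact: sub_d_surj.
- by move=> i ji; apply: IHj; rewrite ?ji // -?ji ltnW.
have := cech_fun_cocycle (@cocycle_incl_linear p) zc.
apply: cech_sub_acyclic => J _; apply: loc_sub_acyclic => k.
exact: Md.
Qed.

Let J0 : {set 'I_(fg_num irr)} := finset.set0.

Lemma cech_prod0 : cech_prod J0 = 1.
Proof. exact: big_set0. Qed.

(** An element of M as a 0-cochain, through M = M_{x_J} for empty J. *)
Definition cech_unit (m : M) : cech irr M := cech_single (cfrac J0 m 0).

Lemma cech_unit_eq0 (m : M) : cech_unit m = 0 -> m = 0.
Proof.
move=> /(congr1 (fun c : cech irr M => c J0)).
rewrite /cech_unit /cech_single dfwith_in => h.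
have /fracP[e] : cfrac J0 m 0 = cfrac J0 0 0 by rewrite h frac0.
by rewrite scaler0 cech_prod0 expr1n scale1r.
Qed.

Lemma cech_unit_d (m : M) J :
  #|J| = 1%N -> cech_d (cech_unit m) J = cfrac J m 0.
Proof.
move=> /eqP/cards1P[j ->]; rewrite /cech_d big_set1.
rewrite [#|_|](_ : _ = 0%N) ?expr0 ?scale1r; last first.
  by apply: eq_card0 => i; rewrite !inE; case: eqVneq => //= ->; rewrite ltnn.
have jE := cech_prodD1 (set11 j).
have : [set j] :\ j = J0 :> {set 'I_(fg_num irr)} by exact: finset.setDv.
move: ([set j] :\ j)%SET jE => K jE KE; rewrite KE in jE *.
by rewrite /cech_unit /cech_single dfwith_in loc_mapE // expr0 scale1r.
Qed.

Lemma cech_unit_linear : linear (cech_unit : restrict (gr_map S) M ->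
  restrict (gr_map S) (cech irr M)).
Proof.
move=> a m m'; apply: functional_extensionality_dep => J.
rewrite -[RHS]/(gr_map S a *: cech_unit m J + cech_unit m' J).
rewrite /cech_unit /cech_single.
have [<-|J0J] := eqVneq J0 J; last by rewrite !dfwith_out // scaler0 addr0.
by rewrite !dfwith_in fracZ fracD cech_prod0 !scale1r.
Qed.

Lemma cech_unit_sub (m : component M nu) :
  cech_sub M 0 nu (cech_unit (val m)).
Proof.
split=> [J|J]; rewrite /cech_unit /cech_single.
  by move=> J_n0; rewrite dfwith_out //; apply: contraNneq J_n0 => <-;
    rewrite cards0.
have [<-|J0J] := eqVneq J0 J; last first.
  by rewrite dfwith_out //; exact: (sm_set0 (loc_sub M J nu)).
rewrite dfwith_in; exists (val m), 0%N; split=> //.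
by rewrite mul0n addr0; exact: sm_set_val.
Qed.

(** The map M_nu -> E^1 sending m to the family of the m / 1 in the M_{x_i}. *)
Definition augmentation (m : component M nu) : submod_type (cech_sub M 1 nu) :=
  cocycle_incl (sub_d (to_sub (cech_sub M 0 nu) (cech_unit (val m)))).

Lemma augmentationE (m : component M nu) :
  val (augmentation m) = cech_d (cech_unit (val m)).
Proof.
rewrite cocycle_inclE to_subK; last exact: cech_d_cocycle_sub.
by rewrite to_subK //; exact: cech_unit_sub.
Qed.

Lemma augmentation_linear : linear augmentation.
Proof.
move=> a u v; rewrite -cocycle_incl_linear -sub_d_linear.
congr (cocycle_incl (sub_d _)).
move: a u v; apply: to_sub_linear => [a u v|]; last exact: cech_unit_sub.
by rewrite val_sub_linear; exact: cech_unit_linear.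
Qed.

Lemma augmentation_inj : injective augmentation.
Proof.
move=> u v uv; apply/eqP; rewrite -subr_eq0; apply/eqP/val_inj.
apply: cech_unit_eq0; set w := u - v.
have [|b [b0 _ ->]] := homogeneous_primitive (@vanish 0) _ (cech_unit_sub w).2.
  split; first exact: (cech_unit_sub w).1.
  by rewrite -augmentationE (linfB augmentation_linear) uv subrr.
have -> : b = 0 by apply: functional_extensionality_dep => J; exact: b0.
exact: cech_d0.
Qed.

Lemma augmentation_exact (c : submod_type (cech_sub M 1 nu)) :
  sub_d c = 0 -> exists m, augmentation m = c.
Proof.
move=> /(congr1 val); rewrite to_subK; last exact: cech_d_cocycle_sub.
move=> dc; have [c1 cnu] := sm_set_val c.
have [b [b0 bnu cE]] := homogeneous_primitive (@vanish 1) (conj c1 dc) cnu.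
have [m [k [mc bE]]] := bnu J0.
have mP : gm_comp M nu m by rewrite cards0 muln0 addr0 in mc.
exists (to_sub (gm_comp M nu) m); apply: val_inj.
rewrite augmentationE to_subK //.
rewrite cE; congr cech_d; apply: functional_extensionality_dep => J.
rewrite /cech_unit /cech_single; have [<-|J0J] := eqVneq J0 J.
  rewrite dfwith_in bE; apply/fracP; exists 0%N.
  by rewrite cech_prod0 !expr1n.
by rewrite dfwith_out // b0 // eqSS cards_eq0 eq_sym.
Qed.

(** In 0 -> M_nu -> E^1 -> Z^2 -> 0 the first map induces an injection on H^d,
since H^{d-1}(Z^2) = 0; but when H^d(M_{nu+1}) = 0 it is zero on H^d, since its
components m / 1 = x_i m / x_i factor through M_{nu+1}. *)
Lemma component_acyclic d :
  (forall (k : nat) j, (j < d)%N -> acyclic I (component M (nu + k%:Z)) j) ->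
  acyclic I (component M (nu + 1)) d -> acyclic I (component M nu) d.
Proof.
move=> Md Md1 z zc.
apply: (coboundary_of_short_exact augmentation_linear (@sub_d_linear 1)) (zc) _.
- exact: augmentation_inj.
- move=> u; apply: val_inj; rewrite to_subK; last exact: cech_d_cocycle_sub.
  by rewrite augmentationE cech_dd.
- exact: augmentation_exact.
- exact: sub_d_surj.
- by move=> i di; apply: (cocycle_sub_acyclic Md); rewrite // di.
(* The sets [J] with one element stand for the generators: [f J] is
multiplication by the generator, from degree [nu] to [nu + 1]. *)
pose f J (u : component M nu) : component M (nu + (1 * #|J|)%:Z) :=
  component_mul (cech_prod J) _ u.
have deg J : nu + (1 * #|J|)%:Z = #|J|%:Z + nu by rewrite mul1n addrC.
have fL J : linear (f J).
  exact: component_mul_linear (gr_comp_cech_prod J) (deg J).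
rewrite (eq_cech_fun (g := fun u =>
  \sum_(J : {set 'I_(fg_num irr)} | #|J| == 1%N)
    single_sub 1 (component_frac (f J u)))).
  apply: (@coboundary_fun_sum _ _ _ _ _ _ _ _ _ _ f
    (fun J u => single_sub 1 (component_frac u))) => J J1.
  - exact: fL.
  - move=> a u v; rewrite component_frac_linear.
    exact: single_sub_linear.
  - have Jd : acyclic I (component M (nu + (1 * #|J|)%:Z)) d.
      by rewrite (eqP J1).
    by apply: Jd; apply: (cech_fun_cocycle (fL J)); exact: zc.
move=> u; apply: single_sub_sum => J J1.
rewrite component_fracE (component_mulE _ (gr_comp_cech_prod J)) //.
rewrite augmentationE cech_unit_d //.
by apply/fracP; exists 0%N; rewrite expr0 scale1r expr1.
Qed.

End Vanishing.

End Acyclicity.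

(** * Truncations *)

Section Above.
Variables (R : comPzRingType) (S : std_graded_algebra R) (M : graded_module S).
Variables (I : fg_ideal R) (r : \bar int).
Implicit Types nu : int.

Let above_sub : submodule (restrict (gr_map S) M) :=
  Submodule (@above_closed R S M r).

Definition above_incl nu (m : component M nu) : above M r :=
  to_sub above_sub (val m).

Definition above_proj nu (u : above M r) : component M nu :=
  to_sub (gm_comp M nu) (gproj nu (val u)).

Lemma component_above nu (m : component M nu) :
  (r < nu%:E)%E -> above_sub (val m).
Proof.
move=> rnu; exists [:: (nu, val m)]; rewrite big_seq1; split=> // x.
by rewrite inE => /eqP -> /=; split=> //; exact: sm_set_val m.
Qed.

Lemma above_incl_linear nu : (r < nu%:E)%E -> linear (@above_incl nu).
Proof.
move=> rnu; apply: to_sub_linear => [|u]; last exact: component_above.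
exact: val_sub_linear.
Qed.

Lemma above_proj_linear nu : linear (above_proj nu).
Proof.
apply: to_sub_linear => [a u v|u]; last exact: gproj_comp.
by rewrite val_sub_linear gproj_linear.
Qed.

Lemma above_inclK nu : (r < nu%:E)%E -> cancel (@above_incl nu) (above_proj nu).
Proof.
move=> rnu m; apply: val_inj; rewrite to_subK; last exact: gproj_comp.
rewrite to_subK; last exact: component_above.
by rewrite (gproj_homogeneous _ (sm_set_val m)) eqxx.
Qed.

Lemma gproj_above nu (u : above M r) :
  ~~ (r < nu%:E)%E -> gproj nu (val u) = 0.
Proof.
move=> rnu; have [s [sP ->]] := sm_set_val u.
rewrite (linf_sum (gproj_linear _)) big_seq big1 // => x /sP[rx Mx].
rewrite (gproj_homogeneous _ Mx); case: eqP => // nux.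
by rewrite nux rx in rnu.
Qed.

(** A component in degree > r is a direct summand of the truncation. *)
Lemma component_acyclic_above nu j :
  (r < nu%:E)%E -> acyclic I (above M r) j -> acyclic I (component M nu) j.
Proof.
move=> rnu Mj z zc; rewrite -[z]cech_fun_id -(eq_cech_fun (above_inclK rnu)).
have iL := above_incl_linear rnu.
rewrite (cech_fun_comp (@above_proj_linear nu) iL z).
apply: (cech_fun_coboundary (@above_proj_linear nu)); apply: Mj.
exact: (cech_fun_cocycle iL).
Qed.

(** The truncation is an infinite direct sum of components, but a cochain has
finitely many numerators and so meets finitely many of them. *)
Lemma above_acyclic j :
  (forall nu, (r < nu%:E)%E -> acyclic I (component M nu) j) ->
  acyclic I (above M r) j.
Proof.
move=> Mj z zc.
pose sup J := sval (cid (gproj_sum (val (repr (z J)).1))).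
(* [s] contains every degree in which some numerator of [z] is nonzero. *)
pose s := undup (flatten [seq sup J | J : {set 'I_(fg_num I)}]).
pose e (u : above M r) : above M r :=
  \sum_(nu <- s | (r < nu%:E)%E) above_incl (above_proj nu u).
have eL : linear e.
  apply: sum_linear => nu rnu a u v.
  by rewrite above_proj_linear above_incl_linear.
have <- : cech_fun e z = z.
  apply: functional_extensionality_dep => J; rewrite /cech_fun.
  rewrite {1}(frac_repr (z J)) loc_funE // [RHS]frac_repr; congr (frac _ _ _).
  apply: val_inj; rewrite (linf_sum (@val_sub_linear _ _ _)).
  have sJ : {subset sup J <= s}.
    move=> nu nuJ; rewrite mem_undup; apply/flattenP.
    by exists (sup J) => //; apply: map_f; rewrite mem_enum.
  rewrite [RHS](svalP (cid (gproj_sum _)) s (undup_uniq _) sJ).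
  rewrite [RHS](bigID (fun nu => (r < nu%:E)%E)) /=.
  rewrite [X in _ + X]big1 ?addr0; last first.
    by move=> nu; exact: gproj_above.
  apply: eq_bigr => nu rnu; rewrite to_subK; last exact: component_above.
  by rewrite to_subK //; exact: gproj_comp.
apply: (@coboundary_fun_sum _ _ _ _ _ _ _ _ _ _ above_proj above_incl)
  => nu rnu.
- exact: above_proj_linear.
- exact: above_incl_linear.
- by apply: Mj => //; exact: (cech_fun_cocycle (@above_proj_linear nu)).
Qed.

End Above.

(** * Extrema of sets of extended integers *)

Lemma supremum_max (x0 m : \bar int) (A : set (\bar int)) :
  A m -> ubound A m -> supremum x0 A = m.
Proof.
move=> Am Um; rewrite /supremum ifF; last first.
  by apply/negP => /eqP A0; rewrite A0 in Am.
have mA : supremums A m by split=> // y; exact.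
case: xgetP => [y _ yA|/(_ m)//]; exact: is_subset1_supremums yA mA.
Qed.

Lemma infimum_min (x0 m : \bar int) (A : set (\bar int)) :
  A m -> lbound A m -> infimum x0 A = m.
Proof.
move=> Am Lm; rewrite /infimum ifF; last first.
  by apply/negP => /eqP A0; rewrite A0 in Am.
have mA : infimums A m by split=> // y; exact.
case: xgetP => [y _ yA|/(_ m)//]; exact: is_subset1_infimums yA mA.
Qed.

Lemma int_has_min (B : set int) (n b : int) :
  B b -> (forall x, B x -> n <= x) ->
  exists2 m, B m & forall x, B x -> m <= x.
Proof.
move=> Bb nB.
have H x : B x -> exists k : nat, x = n + k%:Z.
  by move=> /nB nx; exists `|x - n|%N; lia.
have ex : exists k : nat, `[< B (n + k%:Z) >].
  by have [k kE] := H b Bb; exists k; apply/asboolP; rewrite -kE.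
case: (ex_minnP ex) => k /asboolP Bk k_min.
exists (n + k%:Z) => // x Bx; have [l xE] := H x Bx.
by move: Bx; rewrite xE => /asboolP/k_min; lia.
Qed.

(** Either [A] is bounded above and has a maximum, or its supremum is
[+oo]. *)
Lemma le_supremum_int (x0 : \bar int) (A : set int) a :
  A a -> (a%:E <= supremum x0 [set x%:E | x in A])%E.
Proof.
move=> Aa; case: (EM (exists n : int, forall x, A x -> x <= n)) => [[n nA]|nA].
  have [|x|m Am m_min] := @int_has_min [set - x | x in A] (- n) (- a).
  - by exists a.
  - by case=> y /nA yn <-; lia.
  case: Am => x Ax xE; rewrite -xE in m_min.
  have max_x y : A y -> y <= x.
    by move=> Ay; have := m_min (- y); rewrite lerN2; apply; exists y.
  rewrite (@supremum_max _ x%:E) ?lee_fin ?max_x //; first by exists x.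
  by move=> _ [y /max_x yx <-]; rewrite lee_fin.
apply: ge_supremum_Nmem; last by exists a.
exists +oo%E; split=> [y _|y yA]; first exact: leey.
case: y yA => [y|//|] yA; last first.
  by have := yA _ (ex_intro2 _ _ a Aa erefl); rewrite leeNy_eq.
case: nA; exists y => x Ax.
by have := yA x%:E; rewrite lee_fin; apply; exists x.
Qed.

(** If all of [B] lay above [mu], then [B] would be bounded below and its
infimum would be its least element, hence greater than [mu]. *)
Lemma le_infimum_int (x0 : \bar int) (B : set int) (b mu : int) : B b ->
  (infimum x0 [set x%:E | x in B] <= mu%:E)%E -> exists2 nu, B nu & nu <= mu.
Proof.
move=> Bb inf_mu; apply: contrapT => /forall2NP Bmu.
have lt_mu x : B x -> mu < x.
  by move=> Bx; case: (Bmu x) => // /negP; rewrite -ltNge.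
have [m Bm m_min] := int_has_min Bb (fun x Bx => ltW (lt_mu x Bx)).
move: inf_mu; rewrite (@infimum_min _ m%:E); first last.
- by move=> _ [x /m_min mx <-]; rewrite lee_fin.
- by exists m.
by rewrite lee_fin leNgt lt_mu.
Qed.

(** * Depth *)

Variant depth_spec (A : comPzRingType) (I : fg_ideal A) (N : lmodType A) :
    \bar int -> Prop :=
  | DepthInfinite : (forall j, acyclic I N j) -> depth_spec I N +oo
  | DepthFinite (d : nat) : (forall j, (j < d)%N -> acyclic I N j) ->
      ~ acyclic I N d -> depth_spec I N d%:Z%:E.

Lemma depthP (A : comPzRingType) (I : fg_ideal A) (N : lmodType A) :
  depth_spec I N (depth I N).
Proof.
pose P j := `[< ~ acyclic I N j >].
case: (EM (exists j, P j)) => [ex|nex].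
  case: (ex_minnP ex) => d /asboolP nd d_min.
  have lt_d j : (j < d)%N -> acyclic I N j.
    by move=> jd; apply: contrapT => /asboolP/d_min; lia.
  suff -> : depth I N = d%:Z%:E by exact: DepthFinite.
  apply: supremum_max.
    split=> [|j]; first by rewrite lee_fin.
    by rewrite lte_fin => jd h; move: h; apply/acyclicP/lt_d; lia.
  move=> p [_ pP]; rewrite leNgt; apply/negP => dp.
  by apply: nd; apply/acyclicP/pP.
have Nj j : acyclic I N j.
  by apply: contrapT => /asboolP Pj; apply: nex; exists j.
suff -> : depth I N = +oo%E by exact: DepthInfinite.
apply: supremum_max; last by move=> p _; exact: leey.
by split=> // j _; exact/acyclicP.
Qed.

(** * Stability of the depth *)

Lemma depth_ge0 (A : comPzRingType) (I : fg_ideal A) (N : lmodType A) :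
  (0 <= depth I N)%E.
Proof. by case: depthP => // d _ _; rewrite lee_fin. Qed.

Lemma depth_eq (A : comPzRingType) (I : fg_ideal A) (N : lmodType A) (d : nat) :
  (forall j, (j < d)%N -> acyclic I N j) -> ~ acyclic I N d ->
  depth I N = d%:Z%:E.
Proof.
move=> Nd nd; case: depthP => [/(_ d)//|e Ne ne]; congr (_%:Z%:E).
by case: (ltngtP e d) => // [/Nd|/Ne].
Qed.

Lemma le_depth_acyclic (A : comPzRingType) (I : fg_ideal A) (N : lmodType A)
  (d j : nat) : (d%:Z%:E <= depth I N)%E -> (j < d)%N -> acyclic I N j.
Proof.
case: depthP => // e Ne _; rewrite lee_fin => de jd; apply: Ne; lia.
Qed.

(** Below the depth the whole module H^p vanishes; from the depth on, nu + p
exceeds the regularity.  For infinite depth only the first case occurs. *)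
Lemma cohom_comp_eq0 (R : comPzRingType) (S : std_graded_algebra R)
  (M : graded_module S) (nu : int) p (h : cohom (irrelevant_ideal S) M p) :
  (reg M < +oo)%E -> (reg M - depth (irrelevant_ideal S) M < nu%:E)%E ->
  cohom_comp nu h -> h = 0.
Proof.
move=> reg_fin; case: depthP => [Mj _ _|d Md _ r_nu h_nu].
  exact: (acyclicP _ _ _).2.
have [pd|dp] := ltnP p d; first exact/(acyclicP _ _ _).2/Md.
apply: contrapT => h0.
have : ((nu + p%:Z)%:E <= reg M)%E.
  by apply: le_supremum_int; exists p, h; rewrite addrK.
case: (reg M) reg_fin r_nu => // g _; rewrite -EFinB lte_fin lee_fin; lia.
Qed.

(** The depth of M_{nu+1} is at least [d] by hypothesis, and by
[component_acyclic] it cannot exceed the depth of M_nu. *)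
Lemma depth_component_succ (R : comPzRingType) (S : std_graded_algebra R)
  (I : fg_ideal R) (M : graded_module S) (nu : int) (d : nat) :
  (forall p (h : cohom (irrelevant_ideal S) M p), cohom_comp nu h -> h = 0) ->
  (forall k : nat, (d%:Z%:E <= depth I (component M (nu + k%:Z)))%E) ->
  depth I (component M nu) = d%:Z%:E ->
  depth I (component M (nu + 1)) = d%:Z%:E.
Proof.
move=> vanish Md nu_d.
apply: depth_eq => [j jd|nu1_d]; first exact: le_depth_acyclic (Md 1%N) jd.
have : acyclic I (component M nu) d.
  apply: component_acyclic nu1_d => // k j; exact: le_depth_acyclic.
case: depthP nu_d => // e _ ne [ed].
by have -> : d = e by lia.
Qed.

Local Open Scope ereal_scope.

Theorem theorem3p3 (R : comPzRingType) (S : std_graded_algebra R)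
    (I : fg_ideal R) (M : graded_module S) :
  reg M < +oo ->
  let r := reg M - depth (irrelevant_ideal S) M in
  let depths := [set depth I (component M nu) | nu in
                   [set nu : int | r < nu%:E]] in
  let d := infimum +oo depths in
  let mu0 := infimum +oo [set nu%:E | nu in
               [set nu : int | r < nu%:E /\ depth I (component M nu) = d]] in
  [/\ depths d,
      d = depth I (above M r) &
      forall mu : int, mu0 <= mu%:E -> depth I (component M mu) = d].
Proof.
move=> reg_fin r depths d mu0.
have [a ra] : exists a : int, r < a%:E.
  rewrite /r; have := depth_ge0 (irrelevant_ideal S) M.
  case: (reg M) reg_fin (depth _ _) => [g|//|] _ [e|_|//] //.
  - by exists (g - e + 1)%R; rewrite -EFinB lte_fin; lia.
  - by exists 0%R; rewrite ltNyr.
  - by exists 0%R; rewrite ltNyr.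
  - by exists 0%R; rewrite ltNyr.
have vanish nu p (h : cohom (irrelevant_ideal S) M p) :
    r < nu%:E -> cohom_comp nu h -> h = 0%R.
  exact: cohom_comp_eq0.
(* The depths lie in a well-ordered set, so the infimum is attained. *)
have [depths_d d_min] : depths d /\ lbound depths d.
  pose P k := `[< depths k%:Z%:E >].
  case: (EM (exists k : nat, P k)) => [ex|nex].
    case: (ex_minnP ex) => k /asboolP Pk k_min.
    have k_lb : lbound depths k%:Z%:E.
      move=> x xd; case: (xd) => nu _; case: depthP => [_ <-|e _ _ ex'].
        exact: leey.
      rewrite -ex' lee_fin lez_nat; apply: k_min; apply/asboolP.
      by rewrite ex'.
    by rewrite /d (infimum_min _ Pk).
  have depths_oo x : depths x -> x = +oo.
    move=> xd; case: (xd) => nu _; case: depthP => [_ <- //|e _ _ ex].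
    by case: nex; exists e; apply/asboolP; rewrite ex.
  have oo_depths : depths +oo.
    have Ma : depths (depth I (component M a)) by exists a.
    by rewrite -(depths_oo _ Ma).
  have oo_lb : lbound depths +oo by move=> x /depths_oo ->.
  by rewrite /d (infimum_min _ oo_depths).
have d_le nu : r < nu%:E -> d <= depth I (component M nu).
  by move=> rnu; apply: d_min; exists nu.
split=> //.
  case: (depths_d) => nu rnu dE.
  case: (depthP I (above M r)) => [Mj|e Me ne].
    rewrite -dE; case: depthP => // e _; case.
    exact: component_acyclic_above rnu (Mj e).
  apply/eqP; rewrite eq_le; apply/andP; split.
    rewrite leNgt; apply/negP => ed; apply: ne; apply: above_acyclic => mu rmu.
    apply: (@le_depth_acyclic _ _ _ e.+1) => //; apply: le_trans (d_le _ rmu).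
    by move: ed; case: (d) => // x; rewrite lte_fin lee_fin; lia.
  rewrite -dE; case: depthP => [_|k _ nk]; first exact: leey.
  rewrite lee_fin lez_nat leqNgt; apply/negP => /Me Mk; apply: nk.
  exact: component_acyclic_above rnu Mk.
case: (depths_d) => nu0 rnu0 dE mu mu0_mu.
have [nu [rnu nuE] nu_mu] := le_infimum_int (conj rnu0 dE) mu0_mu.
have -> : mu = (nu + `|mu - nu|%N%:Z)%R by lia.
elim: `|mu - nu|%N => [|k IHk]; first by rewrite addr0.
have r_k (l : nat) : r < (nu + k%:Z + l%:Z)%R%:E.
  by apply: lt_le_trans rnu _; rewrite lee_fin; lia.
have -> : (nu + k.+1%:Z = nu + k%:Z + 1)%R by lia.
move: d_le IHk; case: depthP (nuE) => [_ <-|e _ _ <-] d_le IHk.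
  by apply/eqP; rewrite -leye_eq; exact: d_le (r_k 1%N).
apply: depth_component_succ => // [p h|l].
  by apply: vanish; have := r_k 0%N; rewrite addr0.
exact/d_le/r_k.
Qed.
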